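(* Consider the multiple-antenna Rayleigh flat fading channel with coherence time $T=1$, $N$ transmit and $M$ receive antennas, defined by the conditional density (for input $x\in\mathbb{C}^N$, output $y\in\mathbb{C}^M$) $$p(y\mid x)=\frac{\exp\!\big(-\operatorname{tr}\big[(\sigma_Z^2\mathbf{1}_M+(\mathbf{1}_M\otimes x^H)\Sigma(\mathbf{1}_M\otimes x))^{-1}yy^H\big]\big)}{\pi^M\det\big(\sigma_Z^2\mathbf{1}_M+(\mathbf{1}_M\otimes x^H)\Sigma(\mathbf{1}_M\otimes x)\big)},$$ where $\sigma_Z^2>0$ and $\Sigma$ is a Hermitian positive definite $MN\times MN$ matrix. Let $a>0$ and let $\mu_0$ be a capacity-achieving input measure subject to the average power constraint $a$, i.e. $\mu_0$ is a Borel probability measure on $\mathbb{C}^N$ with $\int \frac1N\|x\|^2\,d\mu_0(x)\le a$ and $I(\mu_0;W)=C(a)$. Then $\operatorname{supp}(\mu_0)$ is a bounded subset of $\mathbb{C}^N$.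
   Context: This is the channel $Y=HX+Z$ with $H\in\mathbb{C}^{M\times N}$ complex circularly symmetric Gaussian with zero mean and covariance $\Sigma=\mathbf{E}(H\otimes H^* )$, and $Z$ having i.i.d. $\mathcal{CN}(0,\sigma_Z^2)$ entries, no channel state information at transmitter or receiver. For a Borel probability measure $\mu$ on $\mathbb{C}^N$, $f_\mu(y):=\int p(y\mid x)\,\mu(dx)$ and the mutual information is $I(\mu;W)=\iint p(y\mid x)\log\frac{p(y\mid x)}{f_\mu(y)}\,dy\,d\mu(x)$ (natural logarithm). The capacity is $C(a)=\sup\{I(\mu;W): \mu \text{ a Borel probability measure on } \mathbb{C}^N,\ \int\frac1N\|x\|^2d\mu(x)\le a\}$, and this supremum is attained. $\|x\|^2=\operatorname{tr}(xx^H)=x^Hx$. *)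

(* Defs.v *)
From HB Require Import structures.
From mathcomp Require Import all_boot all_order all_algebra.
From mathcomp Require Import all_classical all_reals all_analysis.
From mathcomp.real_closed Require Import complex mxtens.
Set Implicit Arguments. Unset Strict Implicit. Unset Printing Implicit Defensive.
Import Order.TTheory GRing.Theory Num.Theory.
Import numFieldNormedType.Exports.
Local Open Scope classical_set_scope.
Local Open Scope ring_scope.

(* The product of two sigma-finite measures is sigma-finite (the library     *)
(* proves this, but the canonical instance is not found by inference, so we  *)
(* re-prove it and pack the structure by hand).                              *)
Section ProdSigmaFinite.
Local Open Scope ereal_scope.
Context d1 d2 (T1 : measurableType d1) (T2 : measurableType d2) (R : realType).
Variable m1 : {sigma_finite_measure set T1 -> \bar R}.
Variable m2 : {sigma_finite_measure set T2 -> \bar R}.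
Lemma prod_sigma_finite : sigma_finite setT (m1 \x m2).
Proof.
have /sigma_finiteP[F [TF ndF Foo]] := sigma_finiteT m1.
have /sigma_finiteP[G [TG ndG Goo]] := sigma_finiteT m2.
exists (fun n => F n `*` G n).
 rewrite -setXTT TF TG predeqE => -[x y]; split.
    move=> [/= [n _ Fnx] [k _ Gky]]; exists (maxn n k) => //; split.
    - by move: x Fnx; exact/subsetPset/ndF/leq_maxl.
    - by move: y Gky; exact/subsetPset/ndG/leq_maxr.
  by move=> [n _ []/= ? ?]; split; exists n.
move=> k; have [? ?] := Foo k; have [? ?] := Goo k.
split; first exact: measurableX.
by rewrite product_measure1E// lte_mul_pinfty// ge0_fin_numE.
Qed.
End ProdSigmaFinite.

(* Lebesgue (product Borel) measure on R^n, built as the iterated product    *)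
(*   R^n := R * (R * ( ... * (R * unit))),  leb_n := leb \x (leb \x ... \x d_tt). *)
Section LebPow.
Variable R : realType.

Record msp := MSp { msp_d : measure_display; msp_T : measurableType msp_d;
  msp_mu : {sigma_finite_measure set msp_T -> \bar R} }.

Definition msp0 : msp := @MSp _ unit (@dirac _ unit tt R).

Definition mspS (P : msp) : msp :=
  @MSp _ _ (HB.pack_for ({sigma_finite_measure set _ -> \bar R})
    (@lebesgue_measure R \x msp_mu P)%E
    (Measure_isSigmaFinite.Build _ _ _ (@lebesgue_measure R \x msp_mu P)%E
       (@prod_sigma_finite _ _ _ _ R (@lebesgue_measure R) (msp_mu P)))).

Fixpoint leb_pow (n : nat) : msp :=
  match n with 0 => msp0 | n.+1 => mspS (leb_pow n) end.

Definition Rn (n : nat) : measurableType (msp_d (leb_pow n)) := msp_T (leb_pow n).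
Definition lebn (n : nat) : {sigma_finite_measure set Rn n -> \bar R} :=
  msp_mu (leb_pow n).

Fixpoint coords (n : nat) : Rn n -> seq R :=
  match n return Rn n -> seq R with
  | 0 => fun _ => [::]
  | n.+1 => fun p : (R * Rn n)%type => p.1 :: @coords n p.2
  end.
End LebPow.

(* C^n identified with R^(2n): x_k = s_(2k) + i s_(2k+1).  Borel sets and    *)
(* Lebesgue measure on C^n are those of R^(2n) via this identification.     *)
Section Complex.
Variable R : realType.
Local Notation C := R[i].

Definition cvec (n : nat) (p : Rn R (2 * n)) : 'cV[C]_n :=
  \col_(k < n) (nth 0 (coords p) (2 * k) +i* nth 0 (coords p) (2 * k).+1)%C.

Definition mxH (m n : nat) (A : 'M[C]_(m, n)) : 'M[C]_(n, m) := (map_mx Num.conj A)^T.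

Definition sqnorm (n : nat) (x : 'cV[C]_n) : R := complex.Re ((mxH x *m x) 0 0).

Definition herm_pd (n : nat) (S : 'M[C]_n) : Prop :=
  S = mxH S /\ forall v : 'cV[C]_n, v != 0 -> 0 < (mxH v *m S *m v) 0 0.

Definition kronIx (M N : nat) (x : 'cV[C]_N) : 'M[C]_(M * N, M) :=
  castmx (erefl (M * N)%N, muln1 M) ((1%:M : 'M[C]_M) *t x).

Definition covK (M N : nat) (sZ2 : R) (Sigma : 'M[C]_(M * N)) (x : 'cV[C]_N)
  : 'M[C]_M :=
  (sZ2%:C)%C%:M + mxH (kronIx M x) *m Sigma *m kronIx M x.

(* the channel density p(y | x); trace and determinant are real (K is       *)
(* Hermitian positive definite), so we take their real parts                 *)
Definition pdens (M N : nat) (sZ2 : R) (Sigma : 'M[C]_(M * N))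
  (y : 'cV[C]_M) (x : 'cV[C]_N) : R :=
  let K := covK sZ2 Sigma x in
  expR (- complex.Re (\tr (invmx K *m (y *m mxH y))))
  / (pi ^+ M * complex.Re (\det K)).

Section Info.
Variables (M N : nat) (sZ2 : R) (Sigma : 'M[C]_(M * N)).
Local Notation p := (pdens sZ2 Sigma).

Definition fout (mu : {measure set Rn R (2 * N) -> \bar R}) (y : 'cV[C]_M) : R :=
  fine (\int[mu]_x (p y (cvec x))%:E)%E.

Definition mutinf (mu : {measure set Rn R (2 * N) -> \bar R}) : \bar R :=
  (\int[mu]_x \int[lebn R (2 * M)]_y
     (p (cvec y) (cvec x) * ln (p (cvec y) (cvec x) / fout mu (cvec y)))%:E)%E.

Definition power_ok (a : R) (mu : {measure set Rn R (2 * N) -> \bar R}) : Prop :=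
  (\int[mu]_x ((sqnorm (cvec x)) / N%:R)%:E <= a%:E)%E.

Definition chan_capacity (a : R) : \bar R :=
  ereal_sup [set I | exists mu : probability (Rn R (2 * N)) R,
                        power_ok a mu /\ I = mutinf mu].
End Info.

Definition msupport (N : nat) (mu : {measure set Rn R (2 * N) -> \bar R})
  : set 'cV[C]_N :=
  [set x0 | forall r : R, 0 < r ->
     (0 < mu [set x | (sqnorm (cvec x - x0) < r ^+ 2)%R])%E].

Definition bounded_cset (N : nat) (A : set 'cV[C]_N) : Prop :=
  exists B : R, forall x, A x -> sqnorm x <= B.
End Complex.

(* Main.v *)
(** Write [D x] for the divergence of [p(.|x)] from the output density [f0] of a
    maximizer [mu0]. Perturbing [mu0] to [(1 + t u) mu0], with [u] bounded, of mean
    zero and not increasing the power, changes the information by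
    [t * \int u D dmu0 + O(t^2)], so [\int u D dmu0 <= 0]. Suppose that [mu0] charges
    sets arbitrarily far out. Then [f0 y >= c exp(- k |y|^2)] for every [k > 0] and
    some [c > 0], whence [D x = o(|x|^2)]; moreover [D x] tends to infinity, because
    [p(.|x)] flattens out. Removing the mass beyond a huge radius costs little
    information compared with the power it releases, and spending that power on
    moving mass from a fixed ball to a fixed set where [D] is larger gains more than
    was lost: a contradiction.

    The normalization of the complex Gaussian density is obtained by integrating out
    one coordinate at a time, each step passing to a Schur complement. *)
Require Import Defs.
From HB Require Import structures.
From mathcomp Require Import all_boot all_order all_algebra.
From mathcomp Require Import all_classical all_reals all_analysis.
From mathcomp.real_closed Require Import complex mxtens.
From mathcomp Require Import measurable_realfun ring lra.
Import Order.TTheory GRing.Theory Num.Theory.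
Import numFieldNormedType.Exports.
Local Open Scope classical_set_scope.
Local Open Scope ring_scope.
Set Implicit Arguments.
Unset Strict Implicit.

(** The integrand of the mutual information is signed, so neither Tonelli nor linearity applies to
    it directly. The proof replaces it by [kl a b = a ln (a / b) - a + b], which is nonnegative
    pointwise and has the same integral once both densities have mass 1 and the divergence is
    finite. Inequalities are arranged without subtraction, so that they integrate in the extended
    nonnegatives. No derivative in [t] is taken: the quadratic error is a chi-square distance
    between the perturbed and the original output density, at most [k ^+ 2] when the weight stays
    within [k] of 1. The argument about the maximizer is made for an abstract channel with a bounded
    density, an output second moment affine in the input power, Gaussian minorants of arbitrarily
    small exponent far out, and diverging logarithmic moments. For the Rayleigh channel all four
    rest on one matrix estimate: [covK] lies between [sZ2 + l |x|^2] and [sZ2 + L |x|^2] times the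
    identity. The spread of the output thus grows with the input, and a single far annulus charged
    by [mu0] gives [f0] a tail heavier than a prescribed Gaussian. *)

Section DensityProbability.
Context d (T : measurableType d) (R : realType).
Local Open Scope ereal_scope.

(** The proofs about [w] are arguments so that the measure and probability structures can be
    inferred from the term itself. *)
Definition wprob (mu : probability T R) (w : T -> R) (mw : measurable_fun setT w)
    (w0 : forall x, (0 <= w x)%R) (w1 : \int[mu]_x (w x)%:E = 1) (A : set T) :=
  \int[mu]_(x in A) (w x)%:E.

Variables (mu : probability T R) (w : T -> R) (mw : measurable_fun setT w).
Variables (w0 : forall x, (0 <= w x)%R) (w1 : \int[mu]_x (w x)%:E = 1).
Local Notation nu := (wprob mw w0 w1).

Let nu0 : nu set0 = 0. Proof. exact: integral_set0. Qed.

Let nu_ge0 A : 0 <= nu A.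
Proof. by apply: integral_ge0 => x _; rewrite lee_fin. Qed.

Let nu_sigma_additive : semi_sigma_additive nu.
Proof.
move=> F mF tF mUF; rewrite /wprob ge0_integral_bigcup//=.
- by apply: is_cvg_ereal_nneg_natsum_cond => n _ _; exact: nu_ge0.
- by apply/measurable_EFinP; exact: measurable_funTS.
- by move=> x _; rewrite lee_fin.
Qed.

HB.instance Definition _ := isMeasure.Build _ _ _ nu nu0 nu_ge0 nu_sigma_additive.

Let nuT : nu setT = 1. Proof. exact: w1. Qed.

HB.instance Definition _ := Measure_isProbability.Build _ _ _ nu nuT.

Import HBNNSimple.

Let wprob_nnsfun (h : {nnsfun T >-> R}) :
  \int[nu]_x (h x)%:E = \int[mu]_x ((h x)%:E * (w x)%:E).
Proof.
under [LHS]eq_integral do rewrite fimfunE -fsumEFin//.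
rewrite [LHS]ge0_integral_fsum//; last 2 first.
  - by move=> r; exact/measurable_EFinP/measurableT_comp.
  - by move=> n x _; rewrite EFinM nnfun_muleindic_ge0.
under [RHS]eq_integral.
  move=> x xD; rewrite fimfunE -fsumEFin// ge0_mule_fsuml; last first.
    by move=> r; rewrite EFinM nnfun_muleindic_ge0.
  over.
rewrite [RHS]ge0_integral_fsum//; last 2 first.
  - by move=> r; apply/measurable_EFinP; apply: measurable_funM => //;
      exact/measurableT_comp.
  - move=> n x _; rewrite mule_ge0 ?lee_fin//.
    by rewrite -lee_fin EFinM nnfun_muleindic_ge0.
apply: eq_fsbigr => r _.
rewrite integralZl_indic_nnsfun// integral_indic// setIT.
rewrite [X in _ * X](integral_mkcond _ (EFin \o w)).
have [r0|r0] := leP 0%R r.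
  rewrite -ge0_integralZl//.
  - apply: eq_integral => x _; rewrite patchE indicE.
    by case: ifPn => _; rewrite ?mulr1 ?mulr0 ?mule0 ?mul0e.
  - have mhr : measurable (h @^-1` [set r]) by exact: measurable_funPTI.
    apply/(measurable_restrictT _ mhr); apply: measurable_funTS.
    exact/measurable_EFinP.
  - by move=> x _; rewrite patchE; case: ifPn; rewrite // lee_fin.
(* A negative [r] is not a value of [h]: the fibre is empty and both sides vanish. *)
rewrite (_ : h @^-1` [set r] = set0) ?preimage_nnfun0//.
rewrite -integral_mkcond integral_set0 mule0.
by apply/esym/integral0_eq => x _; rewrite indic0 mulr0 mul0e.
Qed.

(** Linearity settles simple functions; monotone convergence on both sides does the rest. *)
Lemma integral_wprob (f : T -> \bar R) : measurable_fun setT f ->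
  (forall x, 0 <= f x) -> \int[nu]_x f x = \int[mu]_x (f x * (w x)%:E).
Proof.
move=> mf f0; pose g := nnsfun_approx measurableT mf.
transitivity (limn (fun n => \int[nu]_x (g n x)%:E)).
  rewrite -monotone_convergence//.
  - by apply: eq_integral => x _; apply/esym/cvg_lim => //; exact: cvg_nnsfun_approx.
  - by move=> n; exact/measurable_EFinP.
  - by move=> n x _; rewrite lee_fin.
  - by move=> x _ a b ab; rewrite lee_fin; exact/lefP/nd_nnsfun_approx.
transitivity (limn (fun n => \int[mu]_x ((g n x)%:E * (w x)%:E))).
  by congr (limn _); apply/funext => n; exact: wprob_nnsfun.
rewrite -monotone_convergence//.
- apply: eq_integral => x _; apply/cvg_lim => //.
  by apply: cvgeZr => //; exact: cvg_nnsfun_approx.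
- by move=> n; apply/measurable_EFinP; exact: measurable_funM.
- by move=> n x _; rewrite lee_fin mulr_ge0.
- move=> x _ a b ab; rewrite lee_fin ler_wpM2r//.
  exact/lefP/nd_nnsfun_approx.
Qed.

End DensityProbability.

(** * Integration of nonnegative real-valued functions *)

Section NonnegativeIntegrals.
Context d (T : measurableType d) (R : realType) (mu : {measure set T -> \bar R}).
Implicit Types f g : T -> R.

Lemma gt0_measurable_funV f : measurable_fun setT f -> (forall x, 0 < f x) ->
  measurable_fun setT (fun x => (f x)^-1).
Proof.
move=> mf f0; rewrite (_ : (fun _ => _) = (fun x => f x `^ (-1))).
  by apply: (measurableT_comp (measurable_powR _)).
by apply/funext => x; rewrite powR_inv1// ltW.
Qed.

Lemma ge0_integralDr f g : measurable_fun setT f -> measurable_fun setT g ->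
  (forall x, 0 <= f x) -> (forall x, 0 <= g x) ->
  (\int[mu]_x (f x + g x)%:E = \int[mu]_x (f x)%:E + \int[mu]_x (g x)%:E)%E.
Proof.
move=> mf mg f0 g0.
by rewrite -ge0_integralD// => [x _||x _|]; rewrite ?lee_fin//; exact/measurable_EFinP.
Qed.

Lemma ge0_integralZlr (k : R) f : measurable_fun setT f ->
  (forall x, 0 <= f x) -> 0 <= k ->
  (\int[mu]_x (k * f x)%:E = k%:E * \int[mu]_x (f x)%:E)%E.
Proof.
move=> mf f0 k0; under eq_integral do rewrite EFinM.
by rewrite ge0_integralZl_EFin// => [x _|]; rewrite ?lee_fin//; exact/measurable_EFinP.
Qed.

Lemma ge0_le_integralr f g : measurable_fun setT f -> measurable_fun setT g ->
  (forall x, 0 <= f x) -> (forall x, f x <= g x) ->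
  (\int[mu]_x (f x)%:E <= \int[mu]_x (g x)%:E)%E.
Proof.
move=> mf mg f0 fg; apply: ge0_le_integral => //.
- by move=> x _; rewrite lee_fin.
- exact/measurable_EFinP.
- exact/measurable_EFinP.
- by move=> x _; rewrite lee_fin.
Qed.

Lemma ge0_integralr_ge0 f : (forall x, 0 <= f x) -> (0 <= \int[mu]_x (f x)%:E)%E.
Proof. by move=> f0; apply: integral_ge0 => x _; rewrite lee_fin. Qed.

End NonnegativeIntegrals.

Lemma integral_cst_probability d (T : measurableType d) (R : realType)
  (mu : probability T R) (r : R) : (\int[mu]_x r%:E = r%:E)%E.
Proof.
rewrite integral_cst// -[RHS]mule1; congr (_ * _)%E; exact: probability_setT.
Qed.

(** * Pointwise inequalities for the integrand of relative entropy *)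

Section DivergenceIntegrand.
Variable R : realType.
Implicit Types a b c e : R.

(** The Bregman form of relative entropy: the correction [- a + b] integrates to 0 between
    probability densities and makes the integrand nonnegative. *)
Definition kl a b := a * ln (a / b) - a + b.

Lemma ln_ge1BV e : 0 < e -> 1 - e^-1 <= ln e.
Proof.
move=> e0; have := @le_ln1Dx R (e^-1 - 1).
rewrite (addrC 1) subrK lnV ?posrE// ltrBrDl subrr invr_gt0 => /(_ e0); lra.
Qed.

(** A pointwise Donsker-Varadhan inequality, from [ln z >= 1 - 1 / z] at [z = a / (b e)]. The case
    [e = 1] is nonnegativity of [kl]. *)
Lemma kl_ge a b e : 0 < a -> 0 < b -> 0 < e -> a * ln e <= kl a b + b * (e - 1).
Proof.
move=> a0 b0 e0; have be : 0 < b * e by rewrite mulr_gt0.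
have := ln_ge1BV (divr_gt0 a0 be).
rewrite -(ler_pM2l a0) mulrBr mulr1 invf_div mulrCA divff ?gt_eqF// mulr1.
rewrite invfM mulrA (lnM (x := a / b)) ?posrE ?divr_gt0 ?invr_gt0//.
rewrite lnV ?posrE// /kl; lra.
Qed.

Lemma kl_ge0 a b : 0 < a -> 0 < b -> 0 <= kl a b.
Proof. by move=> a0 b0; have := kl_ge a0 b0 ltr01; rewrite ln1 subrr !mulr0 addr0. Qed.

(** Changing the reference from [c] to [b] costs [a ln (c / b)], at most [a (c / b - 1)]. All terms
    are placed so that both sides are sums of nonnegative quantities. *)
Lemma kl_perturb a b c : 0 < a -> 0 < b -> 0 < c ->
  kl a b + (a + c) <= kl a c + (b + a * (c / b)).
Proof.
move=> a0 b0 c0; have := ln_ge1BV (divr_gt0 b0 c0).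
rewrite -(ler_pM2l a0) mulrBr mulr1 invf_div !ln_div ?posrE// /kl => h.
rewrite !ln_div ?posrE//; lra.
Qed.

End DivergenceIntegrand.

(** * Integrals over subsets and the perturbing weight *)

Section RestrictedIntegrals.
Context d (T : measurableType d) (R : realType) (mu : probability T R).
Implicit Types (g h : T -> R) (A : set T).

(** The indicator sits inside an integral over the whole space, to match the indicators of
    [shift_weight]. *)
Definition intOn g A : R := fine (\int[mu]_x (\1_A x * g x)%:E)%E.

Let ind_ge0 A x : 0 <= \1_A x :> R.
Proof. by rewrite indicE ler0n. Qed.

Let ind_le1 A x : \1_A x <= 1 :> R.
Proof. by rewrite indicE lern1 leq_b1. Qed.

Let m1 g A : measurable A -> measurable_fun setT g ->
  measurable_fun setT (fun x => \1_A x * g x).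
Proof. by move=> mA mg; apply: measurable_funM => //; exact: measurable_indic. Qed.

Lemma intOnE g A : measurable A -> measurable_fun setT g -> (forall x, 0 <= g x) ->
  (\int[mu]_x (g x)%:E < +oo)%E ->
  (\int[mu]_x (\1_A x * g x)%:E)%E = (intOn g A)%:E.
Proof.
move=> mA mg g0 gfin; have ig0 x : 0 <= \1_A x * g x by rewrite mulr_ge0.
rewrite fineK// ge0_fin_numE ?ge0_integralr_ge0//.
apply: le_lt_trans gfin; apply: ge0_le_integralr => //; first exact: m1.
by move=> x; rewrite ler_piMl.
Qed.

Lemma intOn1 A : measurable A -> (intOn (cst 1) A)%:E = mu A.
Proof.
move=> mA; rewrite -intOnE//; last by rewrite integral_cst_probability ltry.
under eq_integral do rewrite mulr1.
by rewrite integral_indic// setIT.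
Qed.

Lemma le_intOn g h k A : measurable A -> 0 <= k ->
  measurable_fun setT g -> (forall x, 0 <= g x) -> (\int[mu]_x (g x)%:E < +oo)%E ->
  measurable_fun setT h -> (forall x, 0 <= h x) -> (\int[mu]_x (h x)%:E < +oo)%E ->
  (forall x, A x -> g x <= k * h x) -> intOn g A <= k * intOn h A.
Proof.
move=> mA k0 mg g0 gfin mh h0 hfin gh.
have ih0 x : 0 <= \1_A x * h x by rewrite mulr_ge0.
rewrite -lee_fin EFinM -!intOnE// -ge0_integralZlr//; last exact: m1.
apply: ge0_le_integralr.
- exact: m1.
- by apply: measurable_funM => //; exact: m1.
- by move=> x; rewrite mulr_ge0.
- move=> x; rewrite indicE; have [/set_mem/gh|_] := boolP (x \in A).
    by rewrite !mul1r.
  by rewrite !mul0r mulr0.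
Qed.

Lemma intOn_ge0 g A : (forall x, 0 <= g x) -> 0 <= intOn g A.
Proof. by move=> g0; rewrite fine_ge0// ge0_integralr_ge0// => x; rewrite mulr_ge0. Qed.

(** Density of the competitor: [S] receives mass, while the outer region [O] and the set [B] give it
    up. The rates [a] and [b] are chosen later to balance mass and power; [t] is the size of the
    perturbation. *)
Definition shift_weight (t a b : R) (S O B : set T) (x : T) : R :=
  1 + t * (a * \1_S x - \1_O x - b * \1_B x).

Section Weight.
Variables (t a b : R) (S O B : set T).
Hypotheses (mS : measurable S) (mO : measurable O) (mB : measurable B).
Hypotheses (t0 : 0 <= t) (a0 : 0 <= a) (b0 : 0 <= b).
Local Notation w := (shift_weight t a b S O B).

Lemma measurable_shift_weight : measurable_fun setT w.
Proof.
apply: measurable_funD => //; apply: measurable_funM => //.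
by apply: measurable_funB; [apply: measurable_funB|];
  try apply: measurable_funM => //; exact: measurable_indic.
Qed.

Lemma shift_weight_near1 x : `|w x - 1| <= t * (1 + a + b).
Proof.
rewrite /shift_weight addrC addrA addNr add0r normrM (ger0_norm t0) ler_wpM2l//.
have := (ind_ge0 S x, ind_le1 S x, ind_ge0 O x, ind_le1 O x, ind_ge0 B x, ind_le1 B x).
move: (\1_S x) (\1_O x) (\1_B x) => i j k [[[[[i0 i1] j0] j1] k0] k1].
have ai : a * i <= a by rewrite ler_piMr.
have bk : b * k <= b by rewrite ler_piMr.
have ai0 : 0 <= a * i by rewrite mulr_ge0.
have bk0 : 0 <= b * k by rewrite mulr_ge0.
rewrite ler_norml; apply/andP; split; lra.
Qed.

Lemma integral_shift_weight g : (forall x, 0 <= w x) ->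
  measurable_fun setT g -> (forall x, 0 <= g x) ->
  (\int[mu]_x (g x)%:E < +oo)%E ->
  (\int[mu]_x (g x * w x)%:E = (fine (\int[mu]_x (g x)%:E)
     + t * (a * intOn g S - intOn g O - b * intOn g B))%:E)%E.
Proof.
move=> w0 mg g0 gfin.
have mw := measurable_shift_weight.
have gE : (\int[mu]_x (g x)%:E = (fine (\int[mu]_x (g x)%:E))%:E)%E.
  by rewrite fineK// ge0_fin_numE// ge0_integralr_ge0.
set G := fine _ in gE *.
have mwg : measurable_fun setT (fun x => g x * w x) by exact: measurable_funM.
have wg0 x : 0 <= g x * w x by rewrite mulr_ge0.
have i0 A x : 0 <= \1_A x * g x by rewrite mulr_ge0.
have k0 A c x : 0 <= c -> 0 <= c * (\1_A x * g x) by move=> c0; rewrite mulr_ge0.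
have mk A c : measurable A -> measurable_fun setT (fun x => c * (\1_A x * g x)).
  by move=> mA; apply: measurable_funM => //; exact: m1.
have ta0 : 0 <= t * a by rewrite mulr_ge0.
have tb0 : 0 <= t * b by rewrite mulr_ge0.
have kE A c : measurable A -> 0 <= c ->
    (\int[mu]_x (c * (\1_A x * g x))%:E = (c * intOn g A)%:E)%E.
  by move=> mA c0; rewrite ge0_integralZlr ?intOnE//; exact: m1.
(* The negative terms of the weight go to the left, so only nonnegative integrals are split; their
   finite value is subtracted at the end. *)
have : (\int[mu]_x (g x * w x + (t * (\1_O x * g x) + t * b * (\1_B x * g x)))%:E
  = \int[mu]_x (g x + t * a * (\1_S x * g x))%:E)%E.
  by apply: eq_integral => x _; congr EFin; rewrite /shift_weight; ring.
have mkO : measurable_fun setT (fun x => t * (\1_O x * g x)) by exact: mk.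
have mkB : measurable_fun setT (fun x => t * b * (\1_B x * g x)) by exact: mk.
have mkS : measurable_fun setT (fun x => t * a * (\1_S x * g x)) by exact: mk.
have kO x : 0 <= t * (\1_O x * g x) by exact: k0.
have kB x : 0 <= t * b * (\1_B x * g x) by exact: k0.
have kS x : 0 <= t * a * (\1_S x * g x) by exact: k0.
have mkOB : measurable_fun setT (fun x => t * (\1_O x * g x) + t * b * (\1_B x * g x)).
  exact: measurable_funD.
have kOB x : 0 <= t * (\1_O x * g x) + t * b * (\1_B x * g x) by rewrite addr_ge0.
rewrite ge0_integralDr// ge0_integralDr// ge0_integralDr//.
rewrite gE !kE// -!EFinD.
move/(congr1 (fun e => e - (t * intOn g O + t * b * intOn g B)%:E)%E).
rewrite addeK// => ->; rewrite -EFinB; congr EFin; ring.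
Qed.

End Weight.
End RestrictedIntegrals.

(** * Output densities and divergences of an abstract channel *)

Section Channel.
Context (R : realType) dX dY (X : measurableType dX) (Y : measurableType dY).
Variables (lam : {sigma_finite_measure set Y -> \bar R}) (p : Y -> X -> R).
Hypothesis mp : measurable_fun setT (fun z : X * Y => p z.2 z.1).
Hypothesis p_gt0 : forall y x, 0 < p y x.
Hypothesis p_int : forall x, (\int[lam]_y (p y x)%:E = 1)%E.
Variables (pmax : R) (nrm : Y -> R) (pw : X -> R) (A B : R).
Hypothesis p_le : forall y x, p y x <= pmax.
Hypothesis mnrm : measurable_fun setT nrm.
Hypothesis nrm_ge0 : forall y, 0 <= nrm y.
Hypothesis mpw : measurable_fun setT pw.
Hypothesis pw_ge0 : forall x, 0 <= pw x.
Hypothesis AB_ge0 : 0 <= A /\ 0 <= B.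
Hypothesis p_mom : forall x,
  (\int[lam]_y (p y x * nrm y)%:E <= (A + B * pw x)%:E)%E.

Let p_ge0 y x : 0 <= p y x. Proof. exact: ltW. Qed.

Let mp_y x : measurable_fun setT (p^~ x).
Proof. exact: (measurableT_comp mp (pair1_measurable x)). Qed.

Let mp_x y : measurable_fun setT (p y).
Proof. exact: (measurableT_comp mp (pair2_measurable y)). Qed.

Definition outd (mu : {measure set X -> \bar R}) y := fine (\int[mu]_x (p y x)%:E).

Definition Div (f : Y -> R) x := (\int[lam]_y (kl (p y x) (f y))%:E)%E.

Section OutputDensity.
Variable mu : probability X R.

Lemma integral_outd y : (\int[mu]_x (p y x)%:E = (outd mu y)%:E)%E.
Proof.
rewrite fineK// ge0_fin_numE ?ge0_integralr_ge0//.
apply: (@le_lt_trans _ _ (\int[mu]_x pmax%:E)%E).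
  exact: ge0_le_integralr.
by rewrite integral_cst_probability ltry.
Qed.

Lemma measurable_outd : measurable_fun setT (outd mu).
Proof.
apply/measurable_EFinP.
rewrite (_ : EFin \o _ = (fun y => \int[mu]_x (p y x)%:E)%E); last first.
  by apply/funext => y; rewrite integral_outd.
apply: (measurable_fun_fubini_tonelli_G (fun z : X * Y => (p z.2 z.1)%:E)).
- exact/measurable_EFinP.
- by move=> z; rewrite lee_fin.
Qed.

Lemma tonelli_outd (g : Y -> R) : measurable_fun setT g -> (forall y, 0 <= g y) ->
  (\int[mu]_x \int[lam]_y (p y x * g y)%:E = \int[lam]_y (outd mu y * g y)%:E)%E.
Proof.
move=> mg g0.
rewrite (fubini_tonelli (fun z : X * Y => (p z.2 z.1 * g z.2)%:E)).
- apply: eq_integral => y _ /=; under eq_integral do rewrite mulrC.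
  by rewrite ge0_integralZlr// integral_outd -EFinM mulrC.
- apply/measurable_EFinP; apply: measurable_funM => //.
  exact: measurableT_comp.
- by move=> z; rewrite lee_fin mulr_ge0.
Qed.

Lemma outd_int : (\int[lam]_y (outd mu y)%:E = 1)%E.
Proof.
have := tonelli_outd (measurable_cst (1 : R)) (fun=> ler01).
under eq_integral do under eq_integral do rewrite mulr1.
under [X in _ = X -> _]eq_integral do rewrite mulr1.
move=> <-; under eq_integral do rewrite p_int.
by rewrite integral_cst_probability.
Qed.

End OutputDensity.

Section Div.
Variables (f : Y -> R).
Hypotheses (mf : measurable_fun setT f) (f_gt0 : forall y, 0 < f y).
Hypothesis f_int : (\int[lam]_y (f y)%:E = 1)%E.

Let mkl : measurable_fun setT (fun z : X * Y => kl (p z.2 z.1) (f z.2)).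
Proof.
have mf2 : measurable_fun setT (fun z : X * Y => f z.2) by exact: measurableT_comp.
apply: measurable_funD => //; apply: measurable_funB => //.
apply: measurable_funM => //; apply: (measurableT_comp (@measurable_ln R)).
by apply: measurable_funM => //; exact: gt0_measurable_funV.
Qed.

Let mkl_y x : measurable_fun setT (fun y => kl (p y x) (f y)).
Proof. exact: (measurableT_comp mkl (pair1_measurable x)). Qed.

Let klpf_ge0 x y : 0 <= kl (p y x) (f y). Proof. exact: kl_ge0. Qed.

Lemma Div_ge0 x : (0 <= Div f x)%E.
Proof. exact: ge0_integralr_ge0. Qed.

Lemma measurable_Div : measurable_fun setT (Div f).
Proof.
apply: (measurable_fun_fubini_tonelli_F (fun z : X * Y => (kl (p z.2 z.1) (f z.2))%:E)).
- exact/measurable_EFinP.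
- by move=> z; rewrite lee_fin.
Qed.

(** Bounding [p] by [pmax] and [f] from below by its minorant gives [ln (p / f) <= L + k * nrm],
    with [L] the absolute value of [ln (pmax / c)]. The moment bound handles [nrm], and the final 1
    is the mass of [f]. *)
Lemma Div_le (c k : R) x : 0 < c -> 0 <= k ->
  (forall y, c * expR (- (k * nrm y)) <= f y) ->
  (Div f x <= (`|ln (pmax / c)| + k * (A + B * pw x) + 1)%:E)%E.
Proof.
move=> c0 k0 cf; have pm0 (y : Y) : 0 < pmax by exact: lt_le_trans (p_gt0 y x) (p_le y x).
set L := `|_|; have L0 : 0 <= L by exact: normr_ge0.
pose g y := L * p y x + k * (p y x * nrm y) + f y.
have mpn : measurable_fun setT (fun y => p y x * nrm y) by exact: measurable_funM.
have mg1 : measurable_fun setT (fun y => L * p y x) by exact: measurable_funM.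
have mg2 : measurable_fun setT (fun y => k * (p y x * nrm y)) by exact: measurable_funM.
have pn0 y : 0 <= p y x * nrm y by rewrite mulr_ge0.
have g10 y : 0 <= L * p y x by rewrite mulr_ge0.
have g20 y : 0 <= k * (p y x * nrm y) by rewrite mulr_ge0.
apply: (@le_trans _ _ (\int[lam]_y (g y)%:E)%E).
  apply: ge0_le_integralr => //.
    by apply: measurable_funD => //; exact: measurable_funD.
  move=> y; rewrite /g /kl lerD2r.
  apply: (@le_trans _ _ (p y x * ln (p y x / f y))).
    by rewrite gerBl.
  rewrite mulrCA (mulrC L) -mulrDr ler_pM2l//.
  have cf0 : 0 < c * expR (- (k * nrm y)) by rewrite mulr_gt0 ?expR_gt0.
  apply: (@le_trans _ _ (ln (pmax / (c * expR (- (k * nrm y)))))).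
    rewrite ler_ln ?posrE ?divr_gt0// ?(pm0 y)//.
    by rewrite ler_pM// ?invr_ge0 ?(ltW (f_gt0 _))// lef_pV2 ?posrE.
  rewrite ln_div ?posrE ?(pm0 y)// lnM ?posrE ?expR_gt0// expRK.
  rewrite opprD opprK addrA lerD2r -ln_div ?posrE ?(pm0 y)//.
  exact: ler_norm.
rewrite ge0_integralDr//; last 3 first.
  - exact: measurable_funD.
  - by move=> y; rewrite addr_ge0.
  - by move=> y; exact: ltW.
rewrite ge0_integralDr// ge0_integralZlr// ge0_integralZlr// f_int p_int mule1.
rewrite [leRHS]EFinD [X in (_ <= X + _)%E]EFinD leeD2r// leeD2l//.
by rewrite EFinM lee_pmul// ?lee_fin// ge0_integralr_ge0.
Qed.

(** The Gaussian minorant makes the divergence finite; only then may [- p + f] be split off as an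
    integrable function of integral 0. *)
Lemma integral_pln (c k : R) x : 0 < c -> 0 <= k ->
  (forall y, c * expR (- (k * nrm y)) <= f y) ->
  (\int[lam]_y (p y x * ln (p y x / f y))%:E = Div f x)%E.
Proof.
move=> c0 k0 cf.
have ikl : lam.-integrable setT (EFin \o (fun y => kl (p y x) (f y))).
  apply/integrableP; split; first exact/measurable_EFinP.
  under eq_integral => y _ do rewrite /= ger0_norm//.
  exact: le_lt_trans (Div_le x c0 k0 cf) (ltry _).
have ip : lam.-integrable setT (EFin \o (p^~ x)).
  apply/integrableP; split; first exact/measurable_EFinP.
  under eq_integral => y _ do rewrite /= ger0_norm//.
  by rewrite p_int ltry.
have if' : lam.-integrable setT (EFin \o f).
  apply/integrableP; split; first exact/measurable_EFinP.
  under eq_integral => y _ do rewrite /= ger0_norm ?ltW//.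
  by rewrite f_int ltry.
transitivity (\int[lam]_y ((EFin \o (fun y => kl (p y x) (f y))) y
    + ((EFin \o (p^~ x)) y - (EFin \o f) y)))%E.
  apply: eq_integral => y _ /=; rewrite -EFinB -EFinD; congr EFin.
  by rewrite /kl; ring.
rewrite integralD//; last exact: integrableB.
rewrite integralB//= p_int f_int subee// adde0//.
Qed.

(** This is [kl_ge] with [e = 1 + nrm y], integrated: the price [f * (e - 1)] is the second moment
    of [f]. *)
Lemma Div_ge x (m : R) : (\int[lam]_y (f y * nrm y)%:E <= m%:E)%E ->
  (\int[lam]_y (p y x * ln (1 + nrm y))%:E <= Div f x + m%:E)%E.
Proof.
move=> fm.
have mfn : measurable_fun setT (fun y => f y * nrm y) by exact: measurable_funM.
have fn0 y : 0 <= f y * nrm y by rewrite mulr_ge0// ltW.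
have n1 y : 0 < 1 + nrm y by rewrite ltr_wpDr.
apply: (@le_trans _ _ (Div f x + \int[lam]_y (f y * nrm y)%:E)%E); last exact: leeD2l.
rewrite -ge0_integralDr//; apply: ge0_le_integralr.
- apply: measurable_funM => //; apply: (measurableT_comp (@measurable_ln R)).
  exact: measurable_funD.
- exact: measurable_funD.
- by move=> y; rewrite mulr_ge0// ln_ge0// lerDl.
- move=> y; have := kl_ge (p_gt0 y x) (f_gt0 y) (n1 y).
  by rewrite [1 + nrm y - 1]addrAC subrr add0r.
Qed.

End Div.

(** Under [nu], replacing the reference [outd nu] by [outd mu] adds the relative entropy of the two
    outputs, which is dominated by their chi-square distance and hence by [k ^+ 2]. *)
Lemma Div_mix (mu nu : probability X R) (k : R) :
  (forall y, 0 < outd mu y) -> (forall y, 0 < outd nu y) -> 0 <= k ->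
  (forall y, `|outd nu y - outd mu y| <= k * outd mu y) ->
  (\int[nu]_x Div (outd mu) x <= \int[nu]_x Div (outd nu) x + (k ^+ 2)%:E)%E.
Proof.
move=> f0 h0 k0 hf; set f := outd mu; set h := outd nu.
have mf : measurable_fun setT f by exact: measurable_outd.
have mh : measurable_fun setT h by exact: measurable_outd.
have fi : (\int[lam]_y (f y)%:E = 1)%E by exact: outd_int.
have hi : (\int[lam]_y (h y)%:E = 1)%E by exact: outd_int.
have hV0 y : 0 <= h y / f y by rewrite divr_ge0// ltW// /f /h.
have mhV : measurable_fun setT (fun y => h y / f y).
  by apply: measurable_funM => //; exact: gt0_measurable_funV.
pose Q x := (\int[lam]_y (p y x * (h y / f y))%:E)%E.
have mQ : measurable_fun setT Q.
  apply: (measurable_fun_fubini_tonelli_F (fun z : X * Y => (p z.2 z.1 * (h z.2 / f z.2))%:E)).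
  - apply/measurable_EFinP; apply: measurable_funM => //.
    exact: (measurableT_comp mhV (@measurable_snd _ _ _ _)).
  - by move=> z; rewrite lee_fin mulr_ge0.
have Q0 x : (0 <= Q x)%E by apply: ge0_integralr_ge0 => y; rewrite mulr_ge0.
have mkly (g : Y -> R) x : measurable_fun setT g -> (forall y, 0 < g y) ->
    measurable_fun setT (fun y => kl (p y x) (g y)).
  move=> mg g0; apply: measurable_funD => //; apply: measurable_funB => //.
  apply: measurable_funM => //; apply: (measurableT_comp (@measurable_ln R)).
  by apply: measurable_funM => //; exact: gt0_measurable_funV.
(* [kl_perturb] integrated over [y]: 2 is the mass of [p] plus that of [h], and 1 is the mass of
   [f]. *)
have main x : (Div f x + 2%:E <= Div h x + (1 + Q x))%E.
  rewrite (_ : 2%:E = 1 + 1 :> \bar R)%E; last by rewrite -EFinD.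
  rewrite -[X in (_ + (X + _) <= _)%E](p_int x) -[X in (_ + (_ + X) <= _)%E]hi.
  rewrite -[X in (_ <= _ + (X + _))%E]fi.
  have f0' y := ltW (f0 y); have h0' y := ltW (h0 y).
  have klf y : 0 <= kl (p y x) (f y) by exact: kl_ge0.
  have klh y : 0 <= kl (p y x) (h y) by exact: kl_ge0.
  have mph : measurable_fun setT (fun y => p y x + h y) by exact: measurable_funD.
  have mphV : measurable_fun setT (fun y => p y x * (h y / f y)) by exact: measurable_funM.
  have mfp : measurable_fun setT (fun y => f y + p y x * (h y / f y)) by exact: measurable_funD.
  have phV0 y : 0 <= p y x * (h y / f y) by rewrite mulr_ge0.
  have ph0 y : 0 <= p y x + h y by rewrite addr_ge0 // h0'.
  have fp0 y : 0 <= f y + p y x * (h y / f y) by rewrite addr_ge0 // f0'.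
  rewrite -ge0_integralDr// -ge0_integralDr//; try exact: mkly.
  rewrite -ge0_integralDr// -ge0_integralDr//; try exact: mkly.
  apply: ge0_le_integralr.
  - by apply: measurable_funD => //; exact: mkly.
  - by apply: measurable_funD => //; exact: mkly.
  - by move=> y; rewrite addr_ge0.
  - by move=> y; exact: kl_perturb.
have mDf := measurable_Div mf f0; have mDh := measurable_Div mh h0.
have Df0 := @Div_ge0 f f0; have Dh0 := @Div_ge0 h h0.
have : (\int[nu]_x (Div f x + 2%:E) <= \int[nu]_x (Div h x + (1 + Q x)))%E.
  apply: ge0_le_integral => //.
  - by move=> x _; exact: adde_ge0.
  - by apply: emeasurable_funD => //; exact: measurable_cst.
  - by apply: emeasurable_funD => //; exact: emeasurable_funD.
have mQ1 : measurable_fun setT (fun x => 1 + Q x)%E by exact: emeasurable_funD.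
have Q10 x : (0 <= 1 + Q x)%E by exact: adde_ge0.
rewrite (@ge0_integralD _ _ _ nu _ _ (Div f) (cst 2%:E))//; last first.
  by move=> x _; rewrite /= lee_fin.
rewrite (@ge0_integralD _ _ _ nu _ _ (Div h) (fun x => 1 + Q x)%E)//.
rewrite (@ge0_integralD _ _ _ nu _ _ (cst 1%:E) Q)//.
rewrite !integral_cst_probability.
suff hQ : (\int[nu]_x Q x <= (1 + k ^+ 2)%:E)%E.
  move=> h1; rewrite -(leeD2rE (x := 2%:E))//.
  move: (integral nu setT (Div h)) (integral nu setT (Div f)) h1 => a b h1.
  apply: le_trans h1 _; rewrite -addeA leeD2l//.
  have -> : ((k ^+ 2)%:E + 2%:E = 1 + (1 + k ^+ 2)%:E :> \bar R)%E.
    by rewrite -!EFinD; congr EFin; ring.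
  exact: leeD2l.
rewrite tonelli_outd// -/h.
have mm : measurable_fun setT (fun y => h y * (h y / f y)) by exact: measurable_funM.
have f0' y : 0 <= f y := ltW (f0 y).
have h0' y : 0 <= h y := ltW (h0 y).
have mk : measurable_fun setT (fun y => k ^+ 2 * f y) by exact: measurable_funM.
have mhh : measurable_fun setT (fun y => h y + h y) by exact: measurable_funD.
have k20 y : 0 <= k ^+ 2 * f y by rewrite mulr_ge0 ?sqr_ge0.
have hh0 y : 0 <= h y + h y by rewrite addr_ge0.
have mm0 y : 0 <= h y * (h y / f y) by rewrite mulr_ge0.
(* Dividing [(h - f)^2 <= k^2 f^2] by [f] and moving the cross term gives
   [h^2 / f + f <= 2 h + k^2 f]; all densities have mass 1. *)
have : (\int[lam]_y (h y * (h y / f y) + f y)%:E <=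
        \int[lam]_y (h y + h y + k ^+ 2 * f y)%:E)%E.
  apply: ge0_le_integralr => //.
  - exact: measurable_funD.
  - exact: measurable_funD.
  - by move=> y; rewrite addr_ge0.
  - move=> y; rewrite -(ler_pM2r (f0 y)) mulrDl mulrA mulfVK ?gt_eqF// -/f.
    have : (h y - f y) ^+ 2 <= (k * f y) ^+ 2.
      by rewrite -[leLHS]real_normK ?num_real// ler_sqr ?nnegrE ?mulr_ge0//; exact: hf.
    by rewrite !expr2; lra.
rewrite ge0_integralDr// ge0_integralDr// ge0_integralDr//.
rewrite ge0_integralZlr ?sqr_ge0// fi hi mule1 -!EFinD => h2.
rewrite -(leeD2rE (x := 1%:E))//; apply: le_trans h2 _.
by rewrite -EFinD lee_fin; lra.
Qed.

(** * Optimality of a maximizer against unbounded support *)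

Section Maximizer.
Hypothesis p_low : forall k : R, 0 < k -> exists R1 : R, forall R2 : R,
  exists2 c : R, 0 < c & forall x, R1 <= pw x <= R2 ->
    forall y, c * expR (- (k * nrm y)) <= p y x.
Hypothesis p_flat : forall G : R, exists R1 : R, forall x, R1 <= pw x ->
  (G%:E <= \int[lam]_y (p y x * ln (1 + nrm y))%:E)%E.

Definition minfo (nu : {measure set X -> \bar R}) : \bar R :=
  (\int[nu]_x \int[lam]_y (p y x * ln (p y x / outd nu y))%:E)%E.

Variable mu0 : probability X R.
Hypothesis pw_fin : (\int[mu0]_x (pw x)%:E < +oo)%E.
Hypothesis mu0_max : forall nu : probability X R,
  (\int[nu]_x (pw x)%:E <= \int[mu0]_x (pw x)%:E)%E -> (minfo nu <= minfo mu0)%E.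
Hypothesis mu0_unbounded : forall R1 : R, exists S : set X, exists R2 : R,
  [/\ measurable S, (0 < mu0 S)%E & forall x, S x -> R1 <= pw x <= R2].

Let f0 := outd mu0.
Let mf0 : measurable_fun setT f0. Proof. exact: measurable_outd. Qed.
Let f0_int : (\int[lam]_y (f0 y)%:E = 1)%E. Proof. exact: outd_int. Qed.

(** A charged set inside an annulus where [p_low] is uniform already contributes the required
    minorant; the constant is [c] times the mass of that set. *)
Lemma outd_mu0_low (k : R) : 0 < k ->
  exists2 c : R, 0 < c & forall y, c * expR (- (k * nrm y)) <= f0 y.
Proof.
move=> /p_low[R1 pR1]; have [S [R2 [mS S0 SR]]] := mu0_unbounded R1.
have [c c0 cp] := pR1 R2.
have SE := intOn1 mu0 mS.
exists (c * intOn mu0 (cst 1) S).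
  by rewrite mulr_gt0// -lte_fin SE.
move=> y; rewrite -lee_fin -integral_outd mulrAC EFinM.
have e0 : 0 <= c * expR (- (k * nrm y)) by rewrite mulr_ge0 ?expR_ge0// ltW.
rewrite -intOnE//; last by rewrite integral_cst_probability ltry.
have i0 x : 0 <= \1_S x * cst 1 x :> R by rewrite mulr1 indicE ler0n.
have mi : measurable_fun setT (fun x => \1_S x * cst 1 x : R).
  by apply: measurable_funM => //; exact: measurable_indic.
rewrite -ge0_integralZlr//; apply: ge0_le_integralr => //.
- exact: measurable_funM.
- by move=> x; rewrite mulr_ge0.
- move=> x; rewrite indicE; have [/set_mem/SR xR|_] := boolP (x \in S).
    by rewrite !mulr1; exact: cp.
  by rewrite mul0r mulr0.
Qed.

Let f0_gt0 y : 0 < f0 y.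
Proof.
have [c c0 cf] := outd_mu0_low ltr01.
by apply: lt_le_trans (cf y); rewrite mulr_gt0 ?expR_gt0.
Qed.

Let dv x := fine (Div f0 x).

Let Div_f0_le (e : R) : 0 < e ->
  exists2 C : R, 0 <= C & forall x, (Div f0 x <= (C + e * pw x)%:E)%E.
Proof.
move=> e0; have [A0 B0] := AB_ge0.
have B10 : 0 < B + 1 by rewrite ltr_wpDl.
(* This exponent turns the slope [k * B] of [Div_le] into at most [e]; the added 1 covers
   [B = 0]. *)
have k0 : 0 < e / (B + 1) by rewrite divr_gt0.
have [c c0 cf] := outd_mu0_low k0.
exists (`|ln (pmax / c)| + e / (B + 1) * A + 1).
  by rewrite !addr_ge0// mulr_ge0// ltW.
move=> x; apply: le_trans (Div_le mf0 f0_gt0 f0_int x c0 (ltW k0) cf) _.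
rewrite lee_fin; suff : e / (B + 1) * (B * pw x) <= e * pw x by lra.
rewrite mulrA ler_wpM2r// mulrAC ler_pdivrMr// ler_pM2l//; lra.
Qed.

Let dvE x : Div f0 x = (dv x)%:E.
Proof.
have [C C0 CD] := Div_f0_le ltr01.
rewrite fineK// ge0_fin_numE ?Div_ge0//; exact: le_lt_trans (CD x) (ltry _).
Qed.

Let dv_ge0 x : 0 <= dv x. Proof. by rewrite -lee_fin -dvE Div_ge0. Qed.

Let mdv : measurable_fun setT dv.
Proof.
apply/measurable_EFinP; rewrite (_ : EFin \o dv = Div f0); first exact: measurable_Div.
by apply/funext => x; rewrite dvE.
Qed.

Let dv_le (e : R) : 0 < e ->
  exists2 C : R, 0 <= C & forall x, dv x <= C + e * pw x.
Proof.
by move=> /Div_f0_le[C C0 CD]; exists C => // x; rewrite -lee_fin -dvE.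
Qed.

(** Finite input power bounds the second moment of [f0] by [m]; [p_flat] at level [G + m] then
    absorbs the loss in [Div_ge]. *)
Let dv_ge (G : R) : exists R1 : R, forall x, R1 <= pw x -> G <= dv x.
Proof.
have [A0 B0] := AB_ge0.
pose m := A + B * fine (\int[mu0]_x (pw x)%:E)%E.
have m_ub : (\int[lam]_y (f0 y * nrm y)%:E <= m%:E)%E.
  rewrite -tonelli_outd//.
  apply: (@le_trans _ _ (\int[mu0]_x (A + B * pw x)%:E)%E).
    apply: ge0_le_integral => //.
    - by move=> x _; apply: ge0_integralr_ge0 => y; rewrite mulr_ge0.
    - apply: (measurable_fun_fubini_tonelli_F (fun z : X * Y => (p z.2 z.1 * nrm z.2)%:E)).
      + apply/measurable_EFinP; apply: measurable_funM => //.
        exact: (measurableT_comp mnrm (@measurable_snd _ _ _ _)).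
      + by move=> z; rewrite lee_fin mulr_ge0.
    - by apply/measurable_EFinP; apply: measurable_funD => //; exact: measurable_funM.
  rewrite (@ge0_integralDr _ _ _ mu0 (cst A) (fun x => B * pw x))//; last 2 first.
  - exact: measurable_funM.
  - by move=> x; rewrite mulr_ge0.
  rewrite integral_cst_probability ge0_integralZlr// /m EFinD EFinM fineK//.
  by rewrite ge0_fin_numE// ge0_integralr_ge0.
have [R1 R1G] := p_flat (G + m).
exists R1 => x /R1G; move=> /le_trans/(_ (Div_ge mf0 f0_gt0 x m_ub)).
by rewrite dvE -EFinD lee_fin lerD2r.
Qed.

Let dv_fin : (\int[mu0]_x (dv x)%:E < +oo)%E.
Proof.
have [C C0 CD] := dv_le ltr01.
apply: (@le_lt_trans _ _ (\int[mu0]_x (C + pw x)%:E)%E).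
  apply: ge0_le_integralr => //; first exact: measurable_funD.
  by move=> x; have := CD x; rewrite mul1r.
rewrite (@ge0_integralDr _ _ _ mu0 (cst C) pw)// integral_cst_probability.
by rewrite lte_add_pinfty// ltry.
Qed.

Let minfo_mu0 : minfo mu0 = (\int[mu0]_x (dv x)%:E)%E.
Proof.
have [c c0 cf] := outd_mu0_low ltr01.
by apply: eq_integral => x _; rewrite (integral_pln mf0 f0_gt0 f0_int x c0 ler01 cf) dvE.
Qed.

(** The output of the reweighted input stays within the factors [1 - k] and [1 + k] of [f0], so
    [Div_mix] applies and maximality bounds the remaining information. The bound [k <= 1/2] keeps
    [1 - k] positive. *)
Let perturb (w : X -> R) (k : R) : measurable_fun setT w -> 0 <= k <= 2^-1 ->
  (forall x, `|w x - 1| <= k) -> (\int[mu0]_x (w x)%:E = 1)%E ->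
  (\int[mu0]_x (pw x * w x)%:E <= \int[mu0]_x (pw x)%:E)%E ->
  (\int[mu0]_x (dv x * w x)%:E <= \int[mu0]_x (dv x)%:E + (k ^+ 2)%:E)%E.
Proof.
move=> mw /andP[k0 k2] wk w1 wpw.
have wb x : 1 - k <= w x <= 1 + k.
  by have := wk x; rewrite ler_norml => /andP[? ?]; apply/andP; split; lra.
have w0 x : 0 <= w x by have /andP[+ _] := wb x; lra.
pose nu : probability X R := wprob mw w0 w1.
have nuE (g : X -> R) : measurable_fun setT g -> (forall x, 0 <= g x) ->
    (\int[nu]_x (g x)%:E = \int[mu0]_x (g x * w x)%:E)%E.
  by move=> mg g0; rewrite integral_wprob//; exact/measurable_EFinP.
have outd_nu y : (outd nu y)%:E = (\int[mu0]_x (p y x * w x)%:E)%E.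
  by rewrite -integral_outd nuE.
have nu_lb y : (1 - k) * f0 y <= outd nu y.
  rewrite -lee_fin outd_nu EFinM -integral_outd -ge0_integralZlr//; last lra.
  apply: ge0_le_integralr => //.
  - exact: measurable_funM.
  - exact: measurable_funM.
  - by move=> x; rewrite mulr_ge0//; lra.
  - by move=> x; rewrite mulrC ler_wpM2l//; have /andP[] := wb x.
have nu_ub y : outd nu y <= (1 + k) * f0 y.
  rewrite -lee_fin outd_nu EFinM -integral_outd -ge0_integralZlr//; last lra.
  apply: ge0_le_integralr => //.
  - exact: measurable_funM.
  - exact: measurable_funM.
  - by move=> x; rewrite mulr_ge0.
  - by move=> x; rewrite [leRHS]mulrC ler_wpM2l//; have /andP[] := wb x.
have k1 : 0 < 1 - k by lra.
have nu_gt0 y : 0 < outd nu y by apply: lt_le_trans (nu_lb y); rewrite mulr_gt0.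
have mnu : measurable_fun setT (outd nu) by exact: measurable_outd.
rewrite -nuE//.
under eq_integral do rewrite -dvE.
apply: le_trans (Div_mix f0_gt0 nu_gt0 k0 _) _.
  by move=> y; rewrite ler_norml; apply/andP; split;
    have := nu_lb y; have := nu_ub y; rewrite -/f0; lra.
apply: leeD2r; rewrite -minfo_mu0.
(* The Gaussian minorant passes to [outd nu] with the factor [1 - k], which allows [integral_pln]
   for [nu] as well. *)
have [c c0 cf] := outd_mu0_low ltr01.
have c10 : 0 < (1 - k) * c by rewrite mulr_gt0.
have cnu y : (1 - k) * c * expR (- (1 * nrm y)) <= outd nu y.
  by apply: le_trans (nu_lb y); rewrite -mulrA ler_pM2l.
apply: le_trans (mu0_max (nu := nu) _); last by rewrite nuE.
rewrite le_eqVlt; apply/orP; left; apply/eqP/eq_integral => x _.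
by rewrite (integral_pln mnu nu_gt0 (outd_int nu) x c10 ler01 cnu).
Qed.

(* Moving the mass lying beyond a huge radius to the origin frees much power;
   since [Div f0] is [o(pw)] this costs little, and spending the freed power on
   pushing mass from [B] out to [S] gains more, because [Div f0] tends to infinity. *)
Lemma maximizer_not_unbounded : False.
Proof.
have [Bs [RB [mB B0 BR]]] := mu0_unbounded 0.
have [C1 C10 C1d] := dv_le ltr01.
pose G' := C1 + `|RB|.
have G'0 : 0 <= G' by rewrite addr_ge0.
have dB x : Bs x -> dv x <= G'.
  move=> /BR/andP[_ xR]; apply: le_trans (C1d x) _; rewrite lerD2l mul1r.
  exact: le_trans xR (ler_norm _).
(* Each unit of mass moved from [Bs] to [S] will gain at least 1. *)
have [R1 R1d] := dv_ge (G' + 1).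
have [S [RS [mS S0 SR]]] := mu0_unbounded R1.
pose R2 := `|RS| + 1.
have R20 : 0 < R2 by rewrite ltr_wpDl.
have SR2 x : S x -> pw x <= R2.
  by move=> /SR/andP[_ xR]; apply: le_trans xR (le_trans (ler_norm _) _); rewrite lerDl.
have dS x : S x -> G' + 1 <= dv x by move=> /SR/andP[xR _]; exact: R1d.
have e0 : 0 < (4 * R2)^-1 by rewrite invr_gt0 mulr_gt0.
have [Ce Ce0 Ced] := dv_le e0.
(* Beyond [r] the constant [Ce] is at most [pw / (4 R2)], so [dv <= pw / (2 R2)] on [O]; also
   [r >= R2], so each unit of mass of [O] carries power at least [R2]. *)
pose r := R2 + 4 * R2 * Ce.
have rR2 : R2 <= r by rewrite lerDl !mulr_ge0// ltW.
pose O := [set x | r <= pw x].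
have mO : measurable O.
  rewrite (_ : O = pw @^-1` `[r, +oo[%classic); last first.
    by apply/seteqP; split => x /=; rewrite in_itv/= andbT.
  by rewrite -[X in measurable X]setTI; apply: mpw => //; exact: measurable_itv.
have dO x : O x -> dv x <= (2 * R2)^-1 * pw x.
  move=> /= xr; apply: le_trans (Ced x) _.
  have : Ce <= (4 * R2)^-1 * pw x.
    rewrite mulrC ler_pdivlMr ?mulr_gt0// mulrC; apply: le_trans xr.
    by rewrite lerDr ltW.
  have -> : (2 * R2)^-1 = (4 * R2)^-1 + (4 * R2)^-1 by field; rewrite gt_eqF.
  rewrite mulrDl; lra.
pose J := intOn mu0.
have one0 (x : X) : 0 <= cst (1 : R) x by [].
have onefin : (\int[mu0]_x (cst (1 : R) x)%:E < +oo)%E.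
  by rewrite integral_cst_probability ltry.
have mone : measurable_fun setT (cst (1 : R) : X -> R) by [].
pose m1 := J (cst 1) S; pose m0 := J (cst 1) Bs; pose eps := J (cst 1) O.
have m10 : 0 < m1 by rewrite -lte_fin /m1 /J intOn1.
have m00 : 0 < m0 by rewrite -lte_fin /m0 /J intOn1.
have eps0 : 0 < eps.
  have [S' [R' [mS' S'0 S'R]]] := mu0_unbounded r.
  rewrite -lte_fin /eps /J intOn1//; apply: lt_le_trans S'0 _.
  by apply: le_measure; rewrite ?inE// => x /S'R/andP[].
pose P := J pw O.
have PE : R2 * eps <= P.
  rewrite -ler_pdivlMl//; apply: le_intOn => //; first by rewrite invr_ge0 ltW.
  move=> x /= xr; rewrite ler_pdivlMl// mulr1; exact: le_trans rR2 xr.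
have P0 : 0 < P by apply: lt_le_trans PE; rewrite mulr_gt0.
(* The power [P] held by [O] pays for mass [eta] placed on [S], where a unit of mass costs at most
   [R2]. *)
pose eta := P / R2.
have eta0 : 0 < eta by rewrite divr_gt0.
have etaeps : eps <= eta by rewrite ler_pdivlMr// mulrC.
have etaR2 : eta * R2 = P by rewrite /eta divfK// gt_eqF.
(* Mass balance: [S] gains [eta], of which [eps] comes from [O] and the rest from [Bs]. *)
pose a := eta / m1; pose b := (eta - eps) / m0.
have a0 : 0 <= a by rewrite divr_ge0// ltW.
have b0 : 0 <= b by rewrite divr_ge0 ?subr_ge0// ltW.
have am1 : a * m1 = eta by rewrite /a divfK// gt_eqF.
have bm0 : b * m0 = eta - eps by rewrite /b divfK// gt_eqF.
have JS : (G' + 1) * m1 <= J dv S.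
  rewrite -ler_pdivlMl; last lra.
  apply: le_intOn => //; first by rewrite invr_ge0; lra.
  by move=> x /dS xd; rewrite ler_pdivlMl ?mulr1//; lra.
have JO : J dv O <= (2 * R2)^-1 * P.
  by apply: le_intOn => //; rewrite invr_ge0 mulr_ge0// ltW.
have JB : J dv Bs <= G' * m0.
  by apply: le_intOn => // x /dB xd; rewrite mulr1.
have JpwS : J pw S <= R2 * m1.
  by apply: le_intOn => //; [rewrite ltW|move=> x /SR2 xd; rewrite mulr1].
have JpwB : 0 <= J pw Bs by exact: intOn_ge0.
(* The three terms are at least [(G' + 1) eta], at most [eta / 2] and at most [G' (eta - eps)]. *)
have gain : eta / 2 <= a * J dv S - J dv O - b * J dv Bs.
  have h1 : a * ((G' + 1) * m1) <= a * J dv S by rewrite ler_wpM2l.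
  have h2 : b * J dv Bs <= b * (G' * m0) by rewrite ler_wpM2l.
  have h3 : (2 * R2)^-1 * P = eta / 2 by rewrite -etaR2; field; rewrite gt_eqF.
  have h4 : a * ((G' + 1) * m1) = (G' + 1) * eta by rewrite -am1; ring.
  have h5 : b * (G' * m0) = G' * (eta - eps) by rewrite -bm0; ring.
  have h6 : 0 <= G' * eps by rewrite mulr_ge0// ltW.
  lra.
pose K := 1 + a + b.
have K0 : 0 < K by rewrite /K; lra.
have K20 : 0 < 4 * K ^+ 2 by rewrite mulr_gt0// exprn_gt0.
(* The first bound gives [t K <= 1/2], as [perturb] requires; the second makes the error [(t K)^2]
   at most [t eta / 4], below the gain [t eta / 2]. *)
pose t := Num.min (2 * K)^-1 (eta / (4 * K ^+ 2)).
have t0 : 0 < t by rewrite lt_min invr_gt0 mulr_gt0// divr_gt0.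
have tK1 : t * K <= 2^-1.
  have -> : 2^-1 = (2 * K)^-1 * K by field; rewrite gt_eqF.
  by rewrite ler_pM2r// ge_min lexx.
have tK2 : t * (4 * K ^+ 2) <= eta.
  by rewrite -ler_pdivlMr// ge_min lexx orbT.
have wnear := shift_weight_near1 S O Bs (ltW t0) a0 b0.
have w0 x : 0 <= shift_weight t a b S O Bs x.
  by have := wnear x; rewrite -/K ler_norml => /andP[? ?]; lra.
have wI (g : X -> R) := integral_shift_weight (mu := mu0) mS mO mB (ltW t0) a0 b0 (g := g) w0.
have w1 : (\int[mu0]_x (shift_weight t a b S O Bs x)%:E = 1)%E.
  have := wI (cst 1) mone one0 onefin.
  under eq_integral do rewrite mul1r.
  move=> ->; rewrite integral_cst_probability /= -/J -/m1 -/m0 -/eps am1 bm0.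
  by congr EFin; ring.
have wpw : (\int[mu0]_x (pw x * shift_weight t a b S O Bs x)%:E
            <= \int[mu0]_x (pw x)%:E)%E.
  rewrite wI// -/J -[leRHS]fineK ?lee_fin ?ge0_fin_numE ?ge0_integralr_ge0//.
  rewrite gerDl pmulr_rle0//.
  have : a * J pw S <= a * (R2 * m1) by rewrite ler_wpM2l.
  have -> : a * (R2 * m1) = P by rewrite -etaR2 -am1; ring.
  have : 0 <= b * J pw Bs by rewrite mulr_ge0.
  by rewrite -/P; lra.
have tK : 0 <= t * K <= 2^-1 by rewrite tK1 mulr_ge0// ltW.
have := perturb (measurable_shift_weight t a b mS mO mB) tK wnear w1 wpw.
rewrite wI// -/J -[X in (_ <= X + _)%E]fineK ?ge0_fin_numE ?ge0_integralr_ge0//.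
apply/negP; rewrite -ltNge -EFinD lte_fin ltrD2l exprMn expr2 -mulrA ltr_pM2l//.
by apply: lt_le_trans gain; lra.
Qed.

End Maximizer.

End Channel.

(** * Measurability of complex and matrix-valued functions *)

Section ComplexMeasurability.
Context (R : realType) d (T : measurableType d).
Local Notation C := R[i].

Definition cmeasurable (f : T -> C) :=
  measurable_fun setT (fun x => complex.Re (f x)) /\
  measurable_fun setT (fun x => complex.Im (f x)).

Lemma cmeasurable_cst (c : C) : cmeasurable (fun=> c).
Proof. by split; exact: measurable_cst. Qed.

Lemma cmeasurableD f g : cmeasurable f -> cmeasurable g ->
  cmeasurable (fun x => f x + g x).
Proof.
move=> [f1 f2] [g1 g2]; split.
  rewrite (_ : (fun _ => _) = fun x => complex.Re (f x) + complex.Re (g x)).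
    exact: measurable_funD.
  by apply/funext => x; rewrite raddfD.
rewrite (_ : (fun _ => _) = fun x => complex.Im (f x) + complex.Im (g x)).
  exact: measurable_funD.
by apply/funext => x; rewrite raddfD.
Qed.

Lemma cmeasurableM f g : cmeasurable f -> cmeasurable g ->
  cmeasurable (fun x => f x * g x).
Proof.
move=> [f1 f2] [g1 g2]; split.
  rewrite (_ : (fun _ => _) = fun x => complex.Re (f x) * complex.Re (g x)
    - complex.Im (f x) * complex.Im (g x)).
    by apply: measurable_funB; exact: measurable_funM.
  by apply/funext => x; case: (f x) (g x) => [a b] [a' b'].
rewrite (_ : (fun _ => _) = fun x => complex.Re (f x) * complex.Im (g x)
    + complex.Im (f x) * complex.Re (g x)).
  by apply: measurable_funD; exact: measurable_funM.
by apply/funext => x; case: (f x) (g x) => [a b] [a' b'].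
Qed.

Lemma cmeasurable_conj f : cmeasurable f -> cmeasurable (fun x => Num.conj (f x)).
Proof.
move=> [f1 f2]; split.
  rewrite (_ : (fun _ => _) = fun x => complex.Re (f x))//.
  by apply/funext => x; case: (f x).
rewrite (_ : (fun _ => _) = fun x => - complex.Im (f x)).
  exact: measurable_funN.
by apply/funext => x; case: (f x).
Qed.

(** In the order on [R[i]], [0 < f x] forces a zero imaginary part, so this is real inversion. *)
Lemma cmeasurableV f : cmeasurable f -> (forall x, 0 < f x) ->
  cmeasurable (fun x => (f x)^-1).
Proof.
move=> [f1 f2] f0; split.
  rewrite (_ : (fun _ => _) = fun x => (complex.Re (f x))^-1).
    apply: gt0_measurable_funV => // x.
    by have := f0 x; case: (f x) => a b; rewrite ltcE => /andP[].
  apply/funext => x; have := f0 x; case: (f x) => a b.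
  rewrite ltcE/= => /andP[/eqP -> a0].
  by rewrite expr0n addr0 expr2 invfM mulrA mulfV ?mul1r// gt_eqF.
rewrite (_ : (fun _ => _) = cst 0); first exact: measurable_cst.
apply/funext => x; have := f0 x; case: (f x) => a b.
by rewrite ltcE/= => /andP[/eqP -> a0]; rewrite mul0r oppr0.
Qed.

Lemma cmeasurable_sum I (r : seq I) (F : I -> T -> C) :
  (forall i, cmeasurable (F i)) -> cmeasurable (fun x => \sum_(i <- r) F i x).
Proof.
move=> mF; elim: r => [|i r IHr].
  by under eq_fun do rewrite big_nil; exact: cmeasurable_cst.
by under eq_fun do rewrite big_cons; exact: cmeasurableD.
Qed.

Lemma cmeasurable_prod I (r : seq I) (F : I -> T -> C) :
  (forall i, cmeasurable (F i)) -> cmeasurable (fun x => \prod_(i <- r) F i x).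
Proof.
move=> mF; elim: r => [|i r IHr].
  by under eq_fun do rewrite big_nil; exact: cmeasurable_cst.
by under eq_fun do rewrite big_cons; exact: cmeasurableM.
Qed.

Definition mxmeasurable m n (f : T -> 'M[C]_(m, n)) :=
  forall i j, cmeasurable (fun x => f x i j).

Lemma mxmeasurable_cst m n (A : 'M[C]_(m, n)) : mxmeasurable (fun=> A).
Proof. by move=> i j; exact: cmeasurable_cst. Qed.

Lemma mxmeasurableD m n (f g : T -> 'M[C]_(m, n)) :
  mxmeasurable f -> mxmeasurable g -> mxmeasurable (fun x => f x + g x).
Proof.
move=> mf mg i j; under eq_fun do rewrite mxE.
exact: cmeasurableD.
Qed.

Lemma mxmeasurableM m n q (f : T -> 'M[C]_(m, n)) (g : T -> 'M[C]_(n, q)) :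
  mxmeasurable f -> mxmeasurable g -> mxmeasurable (fun x => f x *m g x).
Proof.
move=> mf mg i j; under eq_fun do rewrite mxE.
by apply: cmeasurable_sum => k; exact: cmeasurableM.
Qed.

Lemma mxmeasurable_mxH m n (f : T -> 'M[C]_(m, n)) :
  mxmeasurable f -> mxmeasurable (fun x => mxH (f x)).
Proof.
move=> mf i j; under eq_fun do rewrite !mxE.
exact: cmeasurable_conj.
Qed.

Lemma cmeasurable_det n (f : T -> 'M[C]_n) :
  mxmeasurable f -> cmeasurable (fun x => \det (f x)).
Proof.
move=> mf; apply: cmeasurable_sum => s; apply: cmeasurableM.
  exact: cmeasurable_cst.
by apply: cmeasurable_prod => i; exact: mf.
Qed.

(** The cofactor formula; a positive determinant selects the invertible branch of [invmx]
    everywhere. *)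
Lemma mxmeasurable_invmx n (f : T -> 'M[C]_n) : mxmeasurable f ->
  (forall x, 0 < \det (f x)) -> mxmeasurable (fun x => invmx (f x)).
Proof.
move=> mf f0 i j.
rewrite (_ : (fun _ => _) =
    fun x => (\det (f x))^-1 * ((-1) ^+ (j + i) * \det (row' j (col' i (f x))))).
  apply: cmeasurableM; first by apply: cmeasurableV => //; exact: cmeasurable_det.
  apply: cmeasurableM; first exact: cmeasurable_cst.
  apply: cmeasurable_det => k l; under eq_fun do rewrite !mxE.
  exact: mf.
apply/funext => x; rewrite /invmx unitmxE unitfE gt_eqF//.
by rewrite !mxE.
Qed.

End ComplexMeasurability.

Section CvecMeasurability.
Variable R : realType.

Lemma measurable_nth_coords n k :
  measurable_fun setT (fun p : Rn R n => nth 0 (coords p) k).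
Proof.
elim: n k => [|n IHn] [|k] /=; try exact: measurable_cst.
  exact: (@measurable_fst _ _ R (Rn R n)).
exact: (measurableT_comp (IHn k) (@measurable_snd _ _ R (Rn R n))).
Qed.

Lemma mxmeasurable_cvec n : mxmeasurable (@cvec R n).
Proof.
move=> k j; split.
  by under eq_fun do rewrite mxE/=; exact: measurable_nth_coords.
by under eq_fun do rewrite mxE/=; exact: measurable_nth_coords.
Qed.

End CvecMeasurability.

(** * Hermitian forms and two-sided bounds for inverses *)

Section HermitianForms.
Variable R : realType.
Local Notation C := R[i].
Local Notation "x %:C" := (real_complex R x) : ring_scope.

Lemma mxHK m n (A : 'M[C]_(m, n)) : mxH (mxH A) = A.
Proof. by apply/matrixP => i j; rewrite !mxE conjCK. Qed.

Lemma mxHD m n (A B : 'M[C]_(m, n)) : mxH (A + B) = mxH A + mxH B.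
Proof. by apply/matrixP => i j; rewrite !mxE rmorphD. Qed.

Lemma mxHM m n q (A : 'M[C]_(m, n)) (B : 'M[C]_(n, q)) :
  mxH (A *m B) = mxH B *m mxH A.
Proof. by rewrite /mxH map_mxM trmx_mul. Qed.

Lemma mxHZ m n (s : R) (A : 'M[C]_(m, n)) : mxH (s%:C *: A) = s%:C *: mxH A.
Proof.
apply/matrixP => i j; rewrite !mxE rmorphM /=; congr (_ * _).
by rewrite /Num.conj/= /conjc oppr0.
Qed.

Lemma mxH1 n : mxH (1%:M : 'M[C]_n) = 1%:M.
Proof. by rewrite /mxH map_scalar_mx rmorph1 trmx1. Qed.

Lemma mxH0 m n : mxH (0 : 'M[C]_(m, n)) = 0.
Proof. by apply/matrixP => i j; rewrite !mxE rmorph0. Qed.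

Lemma Re_realM (s : R) (z : C) : complex.Re (s%:C * z) = s * complex.Re z.
Proof. by case: z => a b /=; rewrite mul0r subr0. Qed.

Lemma Re_conj (z : C) : complex.Re (Num.conj z) = complex.Re z.
Proof. by case: z. Qed.

(** Taking the real part makes the form real bilinear, so all later estimates are inequalities
    between reals. *)
Definition hform m n (A : 'M[C]_(m, n)) (u : 'cV[C]_m) (v : 'cV[C]_n) : R :=
  complex.Re ((mxH u *m A *m v) 0 0).

Lemma hformDl m n (A : 'M[C]_(m, n)) u u' v :
  hform A (u + u') v = hform A u v + hform A u' v.
Proof. by rewrite /hform mxHD !mulmxDl mxE raddfD. Qed.

Lemma hformDr m n (A : 'M[C]_(m, n)) u v v' :
  hform A u (v + v') = hform A u v + hform A u v'.
Proof. by rewrite /hform mulmxDr mxE raddfD. Qed.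

Lemma hformZl m n (A : 'M[C]_(m, n)) s u v :
  hform A (s%:C *: u) v = s * hform A u v.
Proof. by rewrite /hform mxHZ -!scalemxAl mxE Re_realM. Qed.

Lemma hformZr m n (A : 'M[C]_(m, n)) s u v :
  hform A u (s%:C *: v) = s * hform A u v.
Proof. by rewrite /hform -scalemxAr mxE Re_realM. Qed.

Lemma hform_mxH m n (A : 'M[C]_(m, n)) u v : hform (mxH A) v u = hform A u v.
Proof.
rewrite /hform (_ : mxH v *m mxH A *m u = mxH (mxH u *m A *m v)).
  by rewrite !mxE Re_conj.
by rewrite !mxHM mxHK mulmxA.
Qed.

Lemma sqnormE n (v : 'cV[C]_n) : sqnorm v = hform 1%:M v v.
Proof. by rewrite /hform mulmx1. Qed.

Lemma sqnorm_sum n (v : 'cV[C]_n) :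
  sqnorm v = \sum_i (complex.Re (v i 0) ^+ 2 + complex.Im (v i 0) ^+ 2).
Proof.
rewrite /sqnorm mxE raddf_sum; apply: eq_bigr => i _; rewrite !mxE.
by case: (v i 0) => a b /=; rewrite mulNr opprK !expr2.
Qed.

Let sq_ge0 (z : C) : 0 <= complex.Re z ^+ 2 + complex.Im z ^+ 2.
Proof. by rewrite addr_ge0 ?sqr_ge0. Qed.

Lemma sqnorm_ge0 n (v : 'cV[C]_n) : 0 <= sqnorm v.
Proof. by rewrite sqnorm_sum sumr_ge0. Qed.

Lemma le_sqnorm n (v : 'cV[C]_n) i :
  complex.Re (v i 0) ^+ 2 + complex.Im (v i 0) ^+ 2 <= sqnorm v.
Proof. by rewrite sqnorm_sum (bigD1 i)//= lerDl sumr_ge0. Qed.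

Lemma sqnorm_eq0 n (v : 'cV[C]_n) : (sqnorm v == 0) = (v == 0).
Proof.
apply/eqP/eqP => [v0|->]; last by rewrite /sqnorm mulmx0 mxE.
apply/matrixP => i j; rewrite ord1 mxE.
have := le_sqnorm v i; rewrite v0; case: (v i 0) => a b /= ab.
have a0 : a ^+ 2 = 0 by have := sqr_ge0 a; have := sqr_ge0 b; lra.
have b0 : b ^+ 2 = 0 by have := sqr_ge0 a; have := sqr_ge0 b; lra.
by move: a0 b0 => /eqP + /eqP; rewrite !sqrf_eq0 => /eqP -> /eqP ->.
Qed.

Lemma sqnorm_gt0 n (v : 'cV[C]_n) : (0 < sqnorm v) = (v != 0).
Proof. by rewrite lt_neqAle sqnorm_ge0 andbT eq_sym sqnorm_eq0. Qed.

Lemma sqnorm_mulmx m n (A : 'M[C]_(m, n)) v :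
  sqnorm (A *m v) = hform (mxH A *m A) v v.
Proof. by rewrite /sqnorm /hform mxHM !mulmxA. Qed.

Lemma hform_ub n (A : 'M[C]_n) : exists2 L, 0 < L & forall v, hform A v v <= L * sqnorm v.
Proof.
pose L := \sum_i \sum_j (`|complex.Re (A j i)| + `|complex.Im (A j i)|).
have L0 : 0 <= L by rewrite sumr_ge0// => i _; rewrite sumr_ge0// => j _; rewrite addr_ge0.
exists (L + 1); first by rewrite ltr_wpDl.
move=> v; apply: (@le_trans _ _ (L * sqnorm v)); last first.
  by rewrite ler_wpM2r ?sqnorm_ge0// lerDl.
rewrite /hform mxE raddf_sum mulr_suml ler_sum// => i _.
rewrite mxE mulr_suml raddf_sum mulr_suml ler_sum// => j _; rewrite !mxE.
have := le_sqnorm v i; have := le_sqnorm v j.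
move: (sqnorm v) (v i 0) (v j 0) (A j i) => s [a b] [c e] [x y] /= h1 h2.
(* Real part of one term of the double sum; by the arithmetic-geometric mean inequality each bracket
   is at most [s] in absolute value. *)
rewrite (_ : _ - _ = (a * c + b * e) * x + (a * e - b * c) * y); last by ring.
have h3 : `|a * c + b * e| <= s.
  have := sqr_ge0 (a + c); have := sqr_ge0 (a - c).
  have := sqr_ge0 (b + e); have := sqr_ge0 (b - e).
  rewrite !sqrrD !sqrrN ler_norml => *; apply/andP; split; lra.
have h4 : `|a * e - b * c| <= s.
  have := sqr_ge0 (a + e); have := sqr_ge0 (a - e).
  have := sqr_ge0 (b + c); have := sqr_ge0 (b - c).
  rewrite !sqrrD !sqrrN ler_norml => *; apply/andP; split; lra.
rewrite [leRHS]mulrDl lerD//.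
  apply: le_trans (ler_norm _) _; rewrite normrM mulrC.
  by rewrite ler_wpM2l.
apply: le_trans (ler_norm _) _; rewrite normrM mulrC.
by rewrite ler_wpM2l.
Qed.

Lemma sqnorm_mulmx_ub m n (A : 'M[C]_(m, n)) :
  exists2 L, 0 < L & forall v, sqnorm (A *m v) <= L * sqnorm v.
Proof.
have [L L0 HL] := hform_ub (mxH A *m A).
by exists L => // v; rewrite sqnorm_mulmx.
Qed.

Section PositiveDefinite.
Variables (n : nat) (A : 'M[C]_n).
Hypothesis pdA : herm_pd A.

Let hA : mxH A = A. Proof. by case: pdA => <-. Qed.

Lemma hform_sym u v : hform A u v = hform A v u.
Proof. by rewrite -{1}hA hform_mxH. Qed.

Lemma hform_gt0 v : v != 0 -> 0 < hform A v v.
Proof. by case: pdA => _ /[apply]; rewrite ltcE => /andP[]. Qed.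

Lemma hform_ge0 v : 0 <= hform A v v.
Proof.
have [->|/hform_gt0/ltW//] := eqVneq v 0.
by rewrite /hform mulmx0 mxE.
Qed.

Lemma hform_mulmx v : hform A (A *m v) v = sqnorm (A *m v).
Proof. by rewrite hform_sym /hform sqnorm_mulmx hA /hform !mulmxA. Qed.

Lemma herm_pd_unitmx : A \in unitmx.
Proof.
rewrite unitmxE unitfE; apply/negP => /det0P[v v0 vA].
have : mxH v != 0.
  by apply: contra v0 => /eqP h; rewrite -[v]mxHK h mxH0.
by move=> /hform_gt0; rewrite /hform mxHK vA mul0mx mxE ltxx.
Qed.

(** Expand the nonnegative form at [v - A v / L]; this replaces a square root of [A]. *)
Lemma sqnorm_mulmx_le L v : 0 < L -> (forall u, hform A u u <= L * sqnorm u) ->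
  sqnorm (A *m v) <= L * hform A v v.
Proof.
move=> L0 AL; set w := A *m v.
have := hform_ge0 (v + (- L^-1)%:C *: w).
rewrite hformDl !hformDr !hformZl !hformZr (hform_sym v w) hform_mulmx -/w => h.
have : L^-1 * (L^-1 * hform A w w) <= L^-1 * sqnorm w.
  rewrite ler_pM2l ?invr_gt0//.
  by rewrite mulrC ler_pdivrMr// mulrC.
move=> h'; rewrite -(ler_pM2l (x := L^-1)) ?invr_gt0// mulrA mulVf ?gt_eqF// mul1r; lra.
Qed.

(** Expand the squared norm of [A v - l v]. *)
Lemma sqnorm_mulmx_ge l v : 0 <= l -> (forall u, l * sqnorm u <= hform A u u) ->
  l * hform A v v <= sqnorm (A *m v).
Proof.
move=> l0 Al; set w := A *m v.
have := sqnorm_ge0 (w + (- l)%:C *: v).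
rewrite sqnormE hformDl !hformDr !hformZl !hformZr -!sqnormE.
have -> : hform 1%:M w v = hform A v v.
  by rewrite /hform mulmx1 /w mxHM hA.
have -> : hform 1%:M v w = hform A v v.
  by rewrite /hform mulmx1 /w mulmxA.
have := Al v; move=> /(ler_wpM2l l0); lra.
Qed.

(** Coercivity without compactness: [v] is [invmx A] applied to [A v], hence [|v|^2 <= c |A v|^2],
    and [sqnorm_mulmx_le] bounds [|A v|^2] by the form. *)
Lemma hform_lb : exists2 l, 0 < l & forall v, l * sqnorm v <= hform A v v.
Proof.
have [L L0 AL] := hform_ub A.
have [c c0 Ac] := sqnorm_mulmx_ub (invmx A).
exists (L * c)^-1 => [|v]; first by rewrite invr_gt0 mulr_gt0.
rewrite mulrC ler_pdivrMr ?mulr_gt0// mulrC -mulrA.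
have := Ac (A *m v); rewrite mulKmx ?herm_pd_unitmx// => /le_trans; apply.
rewrite (mulrCA L) ler_pM2l//; exact: sqnorm_mulmx_le.
Qed.

Lemma herm_pd_invmx : herm_pd (invmx A).
Proof.
have uA := herm_pd_unitmx.
have hV : mxH (invmx A) = invmx A.
  apply: (can_inj (mulKmx uA)); rewrite mulmxV//.
  by rewrite -{1}hA -mxHM mulVmx// mxH1.
split=> // v v0; have w0 : invmx A *m v != 0.
  by apply: contra v0 => /eqP h; rewrite -(mulKVmx uA v) h mulmx0.
case: pdA => _ /(_ _ w0); rewrite mxHM hV -!mulmxA mulKVmx//.
Qed.

Lemma hform_invmx_ge L v : 0 < L -> (forall u, hform A u u <= L * sqnorm u) ->
  L^-1 * sqnorm v <= hform (invmx A) v v.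
Proof.
move=> L0 AL; rewrite ler_pdivrMl//.
have := sqnorm_mulmx_le (invmx A *m v) L0 AL; rewrite mulKVmx ?herm_pd_unitmx//.
have [hV _] := herm_pd_invmx.
by rewrite /hform mxHM -hV -!mulmxA mulKVmx ?herm_pd_unitmx.
Qed.

Lemma hform_invmx_le l v : 0 < l -> (forall u, l * sqnorm u <= hform A u u) ->
  hform (invmx A) v v <= l^-1 * sqnorm v.
Proof.
move=> l0 Al; rewrite ler_pdivlMl//.
have := sqnorm_mulmx_ge (invmx A *m v) (ltW l0) Al; rewrite mulKVmx ?herm_pd_unitmx//.
have [hV _] := herm_pd_invmx.
by rewrite /hform mxHM -hV -!mulmxA mulKVmx ?herm_pd_unitmx.
Qed.

End PositiveDefinite.

(** A Hermitian form takes real values on the diagonal, so positivity of the real part is enough. *)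
Lemma herm_pdP n (A : 'M[C]_n) : mxH A = A ->
  (forall v : 'cV_n, v != 0 -> 0 < hform A v v) -> herm_pd A.
Proof.
move=> hA A0; split=> // v v0; rewrite ltcE; apply/andP; split; last exact: A0.
have : mxH (mxH v *m A *m v) = mxH v *m A *m v by rewrite !mxHM mxHK hA mulmxA.
move=> /matrixP/(_ 0 0); rewrite [LHS]mxE [LHS]mxE.
case: (_ 0 0) => a b [] /esym/eqP; rewrite -subr_eq0 opprK -mulr2n mulrn_eq0/=.
by move=> /eqP ->.
Qed.

Lemma herm_pd_scalar n (s : R) : 0 < s -> herm_pd (s%:C%:M : 'M[C]_n).
Proof.
move=> s0; have sE : s%:C%:M = s%:C *: 1%:M :> 'M[C]_n by rewrite scalemx1.
apply: herm_pdP => [|v v0]; first by rewrite sE mxHZ mxH1.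
rewrite sE /hform -scalemxAr -scalemxAl mxE Re_realM -/(hform _ _ _) -sqnormE.
by rewrite mulr_gt0// sqnorm_gt0.
Qed.

End HermitianForms.

(** * Splitting off one complex coordinate *)

Section SchurComplement.
Variables (R : realType) (n : nat) (A : 'M[R[i]]_(1 + n)).
Hypothesis pdA : herm_pd A.
Local Notation "x %:C" := (real_complex R x) : ring_scope.

(** Completing the square: [A = U^H E U] with [U] unipotent and [E] block diagonal with blocks [s]
    and [S]. The determinant and the form both split accordingly. *)
Lemma herm_pd_schur : exists (s : R) (b : 'M[R[i]]_(1, n)) (S : 'M[R[i]]_n),
  [/\ 0 < s, herm_pd S, \det A = s%:C * \det S &
      forall (u : 'cV_1) (v : 'cV_n), hform A (col_mx u v) (col_mx u v) =
        s * sqnorm (u + b *m v) + hform S v v].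
Proof.
have hA : mxH A = A by case: pdA => <-.
have hAE i j : Num.conj (A i j) = A j i by rewrite -[in RHS]hA !mxE.
pose s := complex.Re (A (lshift n 0) (lshift n 0)).
have sE : A (lshift n 0) (lshift n 0) = s%:C.
  have := hAE (lshift n 0) (lshift n 0); rewrite /s; case: (A _ _) => x y [].
  by move=> /esym/eqP; rewrite -subr_eq0 opprK -mulr2n mulrn_eq0/= => /eqP ->.
have s0 : 0 < s.
  have e0 : delta_mx (lshift n 0) 0 != 0 :> 'cV[R[i]]_(1 + n).
    apply/eqP => /matrixP/(_ (lshift n 0) 0); rewrite !mxE !eqxx => /eqP.
    by rewrite oner_eq0.
  have := hform_gt0 pdA e0; rewrite /hform -mulmxA -colE mxE (bigD1 (lshift n 0))//=.
  rewrite !mxE !eqxx rmorph1 mul1r sE big1 ?addr0// => k kn.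
  by rewrite !mxE (negPf kn) rmorph0 mul0r.
pose b := ursubmx A; pose beta := (s^-1)%:C *: b.
pose S := drsubmx A + (- s^-1)%:C *: (mxH b *m b).
have sb : s%:C *: beta = b by rewrite scalerA -rmorphM mulfV ?gt_eqF// scale1r.
have hD : mxH (drsubmx A) = drsubmx A by apply/matrixP => i j; rewrite !mxE hAE.
have blk : A = block_mx (s%:C%:M) b (mxH b) (drsubmx A).
  rewrite -[LHS]submxK; congr block_mx.
    by apply/matrixP => i j; rewrite !ord1 mxE [LHS]mxE sE mxE eqxx mulr1n.
  by apply/matrixP => i j; rewrite !mxE hAE.
pose E := block_mx (s%:C%:M : 'M[R[i]]_1) 0 0 S; pose U := block_mx (1%:M : 'M[R[i]]_1) beta 0 1%:M.
have hU : mxH U = block_mx 1%:M 0 (mxH beta) 1%:M.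
  rewrite /mxH map_block_mx tr_block_mx.
  by congr block_mx; [exact: mxH1|exact: mxH0|exact: mxH1].
have AE : A = mxH U *m E *m U.
  rewrite hU !mulmx_block !(mul0mx, mulmx0, mul1mx, mulmx1, addr0, add0r).
  rewrite mul_scalar_mx mul_mx_scalar sb -mxHZ sb {1}blk; congr block_mx.
  by rewrite /S -scalemxAr addrCA -scalerDl -rmorphD subrr scale0r addr0.
have hS : mxH S = S by rewrite mxHD mxHZ mxHM mxHK hD.
have formE (u : 'cV_1) (v : 'cV_n) : hform A (col_mx u v) (col_mx u v) =
    s * sqnorm (u + beta *m v) + hform S v v.
  have -> : hform A (col_mx u v) (col_mx u v) =
      hform E (U *m col_mx u v) (U *m col_mx u v).
    by rewrite {1}AE /hform mxHM !mulmxA.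
  rewrite mul_block_col !mul1mx mul0mx add0r.
  move: (u + beta *m v) => w.
  rewrite /hform -mulmxA mul_block_col !mul0mx addr0 add0r.
  rewrite (_ : mxH (col_mx w v) = row_mx (mxH w) (mxH v)); last first.
    by rewrite /mxH map_col_mx tr_col_mx.
  rewrite mul_row_col mul_scalar_mx mxE raddfD /= mulmxA; congr (_ + _).
  by rewrite -scalemxAr mxE Re_realM.
exists s, beta, S; split => //.
- apply: herm_pdP => // v v0.
  (* This first coordinate annihilates the square, leaving exactly the form of [S]. *)
  have w0 : col_mx (- (beta *m v)) v != 0.
    by rewrite col_mx_eq0 negb_and v0 orbT.
  have := hform_gt0 pdA w0; rewrite formE addNr.
  by have /eqP -> : sqnorm (0 : 'cV[R[i]]_1) == 0; rewrite ?sqnorm_eq0 ?mulr0 ?add0r.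
- rewrite {1}AE hU !det_mulmx det_lblock det_ublock det_ublock !det1 det_scalar1.
  by rewrite !mul1r !mulr1.
Qed.

End SchurComplement.

(** * Real Gaussian integrals on iterated products *)

Section GaussianIntegral.
Variable R : realType.
Local Notation leb := (@lebesgue_measure R).

Lemma integral_gauss (s m : R) : 0 < s ->
  (\int[leb]_x (expR (- (s * (x + m) ^+ 2)))%:E = (Num.sqrt (pi / s))%:E)%E.
Proof.
(* The integrand is an unnormalized normal density of mean [- m] and variance [1 / (2 s)]. *)
move=> s0; pose sg := Num.sqrt (2 * s)^-1.
have s20 : 0 < (2 * s)^-1 by rewrite invr_gt0 mulr_gt0.
have sg0 : sg != 0 by rewrite gt_eqF// sqrtr_gt0.
have sg2 : sg ^+ 2 = (2 * s)^-1 by rewrite sqr_sqrtr// ltW.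
have q0 : 0 < Num.sqrt (pi / s) by rewrite sqrtr_gt0 divr_gt0 ?pi_gt0.
have := integral_normal_pdf (- m) sg.
have E x : normal_pdf (- m) sg x =
    (Num.sqrt (pi / s))^-1 * expR (- (s * (x + m) ^+ 2)).
  rewrite normal_pdfE// /normal_peak /normal_fun sg2 opprK; congr (_^-1 * expR _).
    by congr Num.sqrt; field; rewrite gt_eqF.
  by field; rewrite gt_eqF.
under eq_integral do rewrite E.
rewrite ge0_integralZlr ?expR_ge0 ?invr_ge0//; last first.
  apply: measurableT_comp => //; apply: measurable_funN; apply: measurable_funM => //.
  by apply: measurable_funX; exact: measurable_funD.
move/(congr1 (fun e => (Num.sqrt (pi / s))%:E * e)%E).
by rewrite muleA -EFinM mulfV ?gt_eqF// mul1e mule1.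
Qed.

Lemma integral_RnS n (F : R * Rn R n -> R) : measurable_fun setT F ->
  (forall z, 0 <= F z) ->
  (\int[lebn R n.+1]_z (F z)%:E = \int[lebn R n]_q \int[leb]_a (F (a, q))%:E)%E.
Proof.
move=> mF F0; apply: (fubini_tonelli2 (m1 := leb) (m2 := lebn R n) (EFin \o F)).
- exact/measurable_EFinP.
- by move=> z; rewrite lee_fin.
Qed.

(** One complex coordinate is two real ones; each integral is insensitive to its shift and yields
    [sqrt (pi / s)]. *)
Lemma integral_gauss_fiber n (s : R) (u v h : Rn R n -> R) : 0 < s ->
  measurable_fun setT u -> measurable_fun setT v -> measurable_fun setT h ->
  (\int[lebn R n.+2]_z
     (expR (- (s * ((z.1 + u z.2.2) ^+ 2 + (z.2.1 + v z.2.2) ^+ 2) + h z.2.2)))%:E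
   = (pi / s)%:E * \int[lebn R n]_q (expR (- h q))%:E)%E.
Proof.
move=> s0 mu mv mh.
have q0 : 0 <= Num.sqrt (pi / s) by exact: sqrtr_ge0.
have m2 : measurable_fun setT (fun z : R * Rn R n => z.2) by exact: measurable_snd.
have mE (k : nat) (g : Rn R k -> R) : measurable_fun setT g ->
    measurable_fun setT (fun q => expR (- g q)).
  by move=> mg; apply: measurableT_comp => //; exact: measurable_funN.
have msq (k : nat) (g : Rn R k -> R) : measurable_fun setT g ->
    measurable_fun setT (fun z : R * Rn R k => s * (z.1 + g z.2) ^+ 2).
  move=> mg; apply: measurable_funM => //; apply: measurable_funX.
  by apply: measurable_funD => //; exact: (measurableT_comp mg (@measurable_snd _ _ _ _)).
have mg2 (k : nat) (g : Rn R k -> R) : measurable_fun setT g ->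
    measurable_fun setT (fun z : R * Rn R k => g z.2).
  by move=> mg; exact: (measurableT_comp mg (@measurable_snd _ _ _ _)).
pose w (q : R * Rn R n) := s * (q.1 + v q.2) ^+ 2 + h q.2.
have mw : measurable_fun setT (w : Rn R n.+1 -> R).
  by apply: measurable_funD; [exact: msq|exact: mg2].
transitivity (\int[lebn R n.+1]_q (Num.sqrt (pi / s) * expR (- w q))%:E)%E.
  rewrite (@integral_RnS n.+1 (fun z => expR (- (s * ((z.1 + u z.2.2) ^+ 2
    + (z.2.1 + v z.2.2) ^+ 2) + h z.2.2)))).
  - apply: eq_integral => q _.
    under eq_integral => a _.
      rewrite (_ : expR _ = expR (- w q) * expR (- (s * (a + u q.2) ^+ 2))); last first.
        by rewrite -expRD /w /=; congr expR; ring.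
      over.
    rewrite ge0_integralZlr ?expR_ge0//; last first.
      apply: measurableT_comp => //; apply: measurable_funN; apply: measurable_funM => //.
      by apply: measurable_funX; exact: measurable_funD.
    by rewrite integral_gauss// -EFinM mulrC.
  - apply: (mE n.+2); under eq_fun do rewrite mulrDr -addrA.
    apply: measurable_funD; last exact: (@mg2 n.+1 w mw).
    by apply: (@msq n.+1 (u \o snd)); exact: mg2.
  - by move=> z; exact: expR_ge0.
rewrite ge0_integralZlr ?expR_ge0//; last exact: mE.
rewrite (@integral_RnS n (fun z => expR (- w z))); last 2 first.
- exact: (mE n.+1).
- by move=> z; exact: expR_ge0.
have E q : (\int[leb]_a (expR (- w (a, q)))%:E
    = (Num.sqrt (pi / s) * expR (- h q))%:E)%E.
  under eq_integral do rewrite /w /= opprD expRD mulrC.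
  rewrite ge0_integralZlr ?expR_ge0//; last first.
    apply: measurableT_comp => //; apply: measurable_funN; apply: measurable_funM => //.
    by apply: measurable_funX; exact: measurable_funD.
  by rewrite integral_gauss// -EFinM mulrC.
under eq_integral do rewrite E.
rewrite ge0_integralZlr//; last exact: mE.
by rewrite muleA -EFinM -expr2 sqr_sqrtr// divr_ge0 ?pi_ge0// ltW.
Qed.

End GaussianIntegral.

(** * Complex Gaussian integrals and determinants *)

Section ComplexGaussian.
Variable R : realType.
Local Notation C := R[i].
Local Notation "x %:C" := (real_complex R x) : ring_scope.

Lemma measurable_hform d (T : measurableType d) m n (f : T -> 'cV[C]_m)
    (A : T -> 'M[C]_(m, n)) (g : T -> 'cV[C]_n) :
  mxmeasurable f -> mxmeasurable A -> mxmeasurable g ->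
  measurable_fun setT (fun x => hform (A x) (f x) (g x)).
Proof.
move=> mf mA mg; have : mxmeasurable (fun x => mxH (f x) *m A x *m g x).
  by apply: mxmeasurableM => //; apply: mxmeasurableM => //; exact: mxmeasurable_mxH.
by move=> /(_ 0 0)[].
Qed.

(* [cvec] with the dimension of the real space as a free parameter: [2 * n.+1]
   and [(2 * n).+2] are not convertible, [n.+1.*2] and [n.*2.+2] are. *)
Definition cvecn m n (p : Rn R m) : 'cV[C]_n :=
  \col_(k < n) (nth 0 (coords p) (2 * k) +i* nth 0 (coords p) (2 * k).+1)%C.

Lemma mxmeasurable_cvecn m n : mxmeasurable (@cvecn m n).
Proof.
move=> k j; split.
  by under eq_fun do rewrite mxE/=; exact: measurable_nth_coords.
by under eq_fun do rewrite mxE/=; exact: measurable_nth_coords.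
Qed.

Lemma cvecnS m n (p : Rn R m.+2) :
  cvecn n.+1 p = col_mx ((p.1 +i* p.2.1)%C%:M : 'cV_1) (cvecn n (p.2.2 : Rn R m)) :> 'cV_(1 + n).
Proof.
apply/matrixP => i j; rewrite !mxE; case: splitP => k ik; rewrite ik.
  by rewrite !ord1 /= mxE eqxx mulr1n.
by rewrite mxE add1n mulnS.
Qed.

(** Positivity of the determinant runs in the same induction, both following from the Schur step. *)
Let gaussian_dbl m n (A : 'M[C]_n) : m = n.*2 -> herm_pd A -> 0 < \det A /\
  (\int[lebn R m]_p (expR (- hform A (cvecn n p) (cvecn n p)))%:E
   = (pi ^+ n / complex.Re (\det A))%:E)%E.
Proof.
move=> ->; elim: n A => [|n IHn] A pdA.
  rewrite det_mx00; split; first exact: ltr01.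
  have E (p : Rn R 0.*2) : hform A (cvecn 0 p) (cvecn 0 p) = 0.
    by rewrite /hform mxE big_ord0.
  under eq_integral do rewrite E oppr0 expR0.
  by rewrite integral_dirac// diracT mul1e expr0 /= divr1.
have [s [b [S [s0 pdS detE formE]]]] := @herm_pd_schur _ n A pdA.
have [detS intS] := IHn S pdS.
have sdetS : 0 < complex.Re (\det S) by move: detS; rewrite ltcE => /andP[].
split; first by rewrite detE; apply: mulr_gt0 => //; rewrite ltcR.
pose f (q : Rn R n.*2) := (b *m cvecn n q) 0 0.
have mf : cmeasurable f.
  apply: (mxmeasurableM (f := fun=> b) (g := @cvecn n.*2 n) _ _ 0 0).
    exact: mxmeasurable_cst.
  exact: mxmeasurable_cvecn.
have E (z : Rn R n.*2.+2) : hform (A : 'M[C]_(1 + n)) (cvecn n.+1 z) (cvecn n.+1 z) =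
    s * ((z.1 + complex.Re (f z.2.2)) ^+ 2 + (z.2.1 + complex.Im (f z.2.2)) ^+ 2)
    + hform S (cvecn n z.2.2) (cvecn n z.2.2).
  rewrite cvecnS formE sqnorm_sum big_ord1 mxE -/(f z.2.2).
  by rewrite [X in X + f _]mxE eqxx mulr1n !raddfD.
under eq_integral do rewrite E.
rewrite (integral_gauss_fiber (u := fun q => complex.Re (f q)) (v := fun q => complex.Im (f q))
  (h := fun q => hform S (cvecn n q) (cvecn n q)))//.
- rewrite intS -EFinM detE Re_realM exprS invfM; congr EFin; ring.
- exact: mf.1.
- exact: mf.2.
- apply: measurable_hform; [|exact: mxmeasurable_cst|];
    exact: mxmeasurable_cvecn.
Qed.

Lemma herm_pd_det_gt0 n (A : 'M[C]_n) : herm_pd A -> 0 < \det A.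
Proof. by case/(gaussian_dbl erefl). Qed.

Lemma integral_cgauss n (A : 'M[C]_n) : herm_pd A ->
  (\int[lebn R (2 * n)]_p (expR (- hform A (cvec p) (cvec p)))%:E
   = (pi ^+ n / complex.Re (\det A))%:E)%E.
Proof. by move=> /(gaussian_dbl (mul2n n))[]. Qed.

Lemma Re_det_gt0 n (A : 'M[C]_n) : herm_pd A -> 0 < complex.Re (\det A).
Proof. by move=> /herm_pd_det_gt0; rewrite ltcE => /andP[]. Qed.

Lemma measurable_hform_cvec n (A : 'M[C]_n) :
  measurable_fun setT (fun p : Rn R (2 * n) => hform A (cvec p) (cvec p)).
Proof.
apply: measurable_hform; [|exact: mxmeasurable_cst|]; exact: mxmeasurable_cvec.
Qed.

(* The Gaussian integral is antitone in the form, which avoids any spectral theory. *)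
Lemma le_det n (A B : 'M[C]_n) : herm_pd A -> herm_pd B ->
  (forall v, hform A v v <= hform B v v) ->
  complex.Re (\det A) <= complex.Re (\det B).
Proof.
move=> pdA pdB AB; have dA := Re_det_gt0 pdA; have dB := Re_det_gt0 pdB.
rewrite -lef_pV2 ?posrE// -(ler_pM2l (x := pi ^+ n)) ?exprn_gt0 ?pi_gt0//.
rewrite -lee_fin -(integral_cgauss pdA) -(integral_cgauss pdB); apply: ge0_le_integralr.
- by apply: measurableT_comp => //; apply: measurable_funN; exact: measurable_hform_cvec.
- by apply: measurableT_comp => //; apply: measurable_funN; exact: measurable_hform_cvec.
- by move=> p; exact: expR_ge0.
- by move=> p; rewrite ler_expR lerN2.
Qed.

End ComplexGaussian.

(** * Estimates for the Rayleigh channel density *)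

Section ChannelBounds.
Variables (R : realType) (M N : nat) (sZ2 : R) (Sigma : 'M[R[i]]_(M * N)).
Hypotheses (sZ20 : 0 < sZ2) (pdS : herm_pd Sigma).
Local Notation C := R[i].
Local Notation "x %:C" := (real_complex R x) : ring_scope.
Local Notation K := (covK sZ2 Sigma).
Local Notation p := (pdens sZ2 Sigma).

Lemma sqnormD_le n (u v : 'cV[C]_n) : sqnorm (u + v) <= 2 * (sqnorm u + sqnorm v).
Proof.
rewrite !sqnorm_sum -big_split mulr_sumr ler_sum// => i _; rewrite !mxE !raddfD /=.
move: (u i 0) (v i 0) => [a b] [c e] /=.
have := sqr_ge0 (a - c); have := sqr_ge0 (b - e); rewrite !expr2; lra.
Qed.

Lemma sqnormN n (u : 'cV[C]_n) : sqnorm (- u) = sqnorm u.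
Proof.
rewrite !sqnorm_sum; apply: eq_bigr => i _; rewrite mxE !raddfN /=.
by rewrite !sqrrN.
Qed.

Lemma mxH_mulmx_self n (x : 'cV[C]_n) : mxH x *m x = (sqnorm x)%:C%:M.
Proof.
rewrite [LHS]mx11_scalar; congr (_%:M).
have : mxH (mxH x *m x) = mxH x *m x by rewrite mxHM mxHK.
rewrite /sqnorm; move=> /matrixP/(_ 0 0); rewrite [LHS]mxE [LHS]mxE.
case: (_ 0 0) => a b [] /esym/eqP; rewrite -subr_eq0 opprK -mulr2n mulrn_eq0/=.
by move=> /eqP ->.
Qed.

Lemma mxH_kronIx_mul (x : 'cV[C]_N) : mxH (kronIx M x) *m kronIx M x = (sqnorm x)%:C%:M.
Proof.
have -> : mxH (kronIx M x) = castmx (muln1 M, erefl) ((1%:M : 'M[C]_M) *t mxH x).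
  rewrite /mxH /kronIx map_castmx map_mxT map_scalar_mx rmorph1.
  by rewrite trmx_cast trmx_tens trmx1.
rewrite /kronIx -castmx_mul tensmx_mul mulmx1 mxH_mulmx_self tens_mx_scalar.
by rewrite castmx_comp castmx_id scalemx1.
Qed.

Lemma hform_covK (x : 'cV[C]_N) v :
  hform (K x) v v = sZ2 * sqnorm v + hform Sigma (kronIx M x *m v) (kronIx M x *m v).
Proof.
rewrite {1}/hform /covK mulmxDr mulmxDl mxE raddfD /=; congr (_ + _).
  by rewrite mul_mx_scalar -scalemxAl mxE Re_realM.
by rewrite /hform mxHM !mulmxA.
Qed.

Lemma sqnorm_kronIx (x : 'cV[C]_N) v : sqnorm (kronIx M x *m v) = sqnorm x * sqnorm v.
Proof.
by rewrite sqnorm_mulmx mxH_kronIx_mul /hform mul_mx_scalar -scalemxAl mxE Re_realM.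
Qed.

Lemma mxH_covK (x : 'cV[C]_N) : mxH (K x) = K x.
Proof.
have [hS _] := pdS; have [hZ _] := @herm_pd_scalar R M _ sZ20.
by rewrite /covK mxHD -hZ !mxHM mxHK -hS mulmxA.
Qed.

Lemma covK_bounds : exists l L : R, [/\ 0 < l, 0 < L &
  forall x v, (sZ2 + l * sqnorm x) * sqnorm v <= hform (K x) v v
    <= (sZ2 + L * sqnorm x) * sqnorm v].
Proof.
have [l l0 Sl] := hform_lb pdS; have [L L0 SL] := hform_ub Sigma.
exists l, L; split => // x v; rewrite hform_covK !mulrDl -!mulrA -sqnorm_kronIx.
by rewrite !lerD2l Sl SL.
Qed.

Lemma herm_pd_covK x : herm_pd (K x).
Proof.
have [l [L [l0 _ Kl]]] := covK_bounds.
apply: herm_pdP => [|v v0]; first exact: mxH_covK.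
have /andP[+ _] := Kl x v; apply: lt_le_trans.
by rewrite mulr_gt0 ?sqnorm_gt0// ltr_wpDr// mulr_ge0 ?sqnorm_ge0// ltW.
Qed.

Lemma hform_scalar n (s : R) (v : 'cV[C]_n) : hform (s%:C%:M) v v = s * sqnorm v.
Proof. by rewrite /hform mul_mx_scalar -scalemxAl mxE Re_realM. Qed.

Lemma Re_det_scalar n (s : R) : complex.Re (\det (s%:C%:M : 'M[C]_n)) = s ^+ n.
Proof. by rewrite det_scalar -rmorphXn. Qed.

Lemma det_covK_ge x (s : R) : 0 < s -> (forall v, s * sqnorm v <= hform (K x) v v) ->
  s ^+ M <= complex.Re (\det (K x)).
Proof.
move=> s0 Ks; rewrite -Re_det_scalar; apply: le_det => [||v].
- exact: herm_pd_scalar.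
- exact: herm_pd_covK.
- by rewrite hform_scalar.
Qed.

Lemma det_covK_le x (s : R) : 0 < s -> (forall v, hform (K x) v v <= s * sqnorm v) ->
  complex.Re (\det (K x)) <= s ^+ M.
Proof.
move=> s0 Ks; rewrite -Re_det_scalar; apply: le_det => [||v].
- exact: herm_pd_covK.
- exact: herm_pd_scalar.
- by rewrite hform_scalar.
Qed.

Lemma pdensE (y : 'cV[C]_M) x :
  p y x = expR (- hform (invmx (K x)) y y) / (pi ^+ M * complex.Re (\det (K x))).
Proof.
rewrite /pdens /hform; congr (expR (- complex.Re _) / _).
by rewrite mulmxA mxtrace_mulC mulmxA /mxtrace big_ord1.
Qed.

Lemma pdens_den_gt0 (x : 'cV[C]_N) : 0 < pi ^+ M * complex.Re (\det (K x)).
Proof. by rewrite mulr_gt0 ?exprn_gt0 ?pi_gt0//; exact/Re_det_gt0/herm_pd_covK. Qed.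

Lemma pdens_gt0 (y : 'cV[C]_M) x : 0 < p y x.
Proof. by rewrite pdensE divr_gt0 ?expR_gt0// pdens_den_gt0. Qed.

Lemma Re_det_invmx n (A : 'M[C]_n) : herm_pd A ->
  complex.Re (\det (invmx A)) = (complex.Re (\det A))^-1.
Proof.
move=> pdA; rewrite det_inv; have := herm_pd_det_gt0 pdA.
case: (\det A) => a b; rewrite ltcE/= => /andP[/eqP -> a0].
by rewrite expr0n addr0 expr2 invfM mulrA mulfV ?mul1r// gt_eqF.
Qed.

Lemma herm_pdZ n (s : R) (A : 'M[C]_n) : 0 < s -> herm_pd A -> herm_pd (s%:C *: A).
Proof.
move=> s0 pdA; apply: herm_pdP => [|v v0].
  by rewrite mxHZ; case: pdA => <-.
by rewrite /hform -scalemxAr -scalemxAl mxE Re_realM mulr_gt0//; exact: hform_gt0.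
Qed.

Lemma measurable_cgauss n (A : 'M[C]_n) :
  measurable_fun setT (fun q : Rn R (2 * n) => expR (- hform A (cvec q) (cvec q))).
Proof.
by apply: measurableT_comp => //; apply: measurable_funN; exact: measurable_hform_cvec.
Qed.

Lemma pdens_cst (y : 'cV[C]_M) x : p y x =
  (pi ^+ M * complex.Re (\det (K x)))^-1 * expR (- hform (invmx (K x)) y y).
Proof. by rewrite pdensE mulrC. Qed.

Lemma pdens_int x : (\int[lebn R (2 * M)]_y (p (cvec y) x)%:E = 1)%E.
Proof.
under eq_integral do rewrite pdens_cst.
have d0 := pdens_den_gt0 x.
have pdV := herm_pd_invmx (herm_pd_covK x).
rewrite ge0_integralZlr ?invr_ge0 ?(ltW d0)//; last exact: measurable_cgauss.
rewrite (integral_cgauss pdV) Re_det_invmx ?invrK; last exact: herm_pd_covK.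
by rewrite -EFinM mulVf ?gt_eqF.
Qed.

Lemma pdens_le (y : 'cV[C]_M) x : p y x <= (pi ^+ M * sZ2 ^+ M)^-1.
Proof.
have d0 := pdens_den_gt0 x; have [l [L [l0 L0 Kl]]] := covK_bounds.
have pi0 : 0 < pi ^+ M :> R by rewrite exprn_gt0 ?pi_gt0.
rewrite pdens_cst -[leRHS]mulr1 ler_pM ?invr_ge0 ?expR_ge0 ?(ltW d0)//.
  have ps0 : 0 < pi ^+ M * sZ2 ^+ M by rewrite mulr_gt0// exprn_gt0.
  rewrite lef_pV2 ?posrE// ler_pM2l// det_covK_ge// => v.
  have /andP[+ _] := Kl x v; apply: le_trans.
  by rewrite ler_wpM2r ?sqnorm_ge0// lerDl mulr_ge0 ?sqnorm_ge0// ltW.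
rewrite -expR0 ler_expR oppr_le0; apply: hform_ge0.
exact/herm_pd_invmx/herm_pd_covK.
Qed.

Let pos_aff (c : R) (x : 'cV[C]_N) : 0 < c -> 0 < sZ2 + c * sqnorm x.
Proof. by move=> c0; rewrite ltr_wpDr// mulr_ge0 ?sqnorm_ge0// ltW. Qed.

Lemma measurable_sqnorm_cvec n :
  measurable_fun setT (fun q : Rn R (2 * n) => sqnorm (cvec q)).
Proof. by under eq_fun do rewrite sqnormE; exact: measurable_hform_cvec. Qed.

(* [t <= 2 exp(t/2)] with [t = y^H K^-1 y] reduces the second moment to another
   Gaussian integral. *)
Lemma pdens_mom : exists A B : R, (0 <= A /\ 0 <= B) /\ forall x,
  (\int[lebn R (2 * M)]_y (p (cvec y) x * sqnorm (cvec y))%:E <= (A + B * sqnorm x)%:E)%E.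
Proof.
have [l [L [l0 L0 Kl]]] := covK_bounds.
(* One factor 2 comes from [t <= 2 exp (t / 2)], and [2 ^+ M] from halving the form in the Gaussian
   integral. *)
exists (2 ^+ M.+1 * sZ2), (2 ^+ M.+1 * L); split.
  by split; rewrite mulr_ge0 ?exprn_ge0// ltW.
move=> x; have d0 := pdens_den_gt0 x; have pdK := herm_pd_covK x.
set D := pi ^+ M * _ in d0; set s := sZ2 + L * sqnorm x.
have s0 : 0 < s by exact: pos_aff.
have pdV := herm_pd_invmx pdK.
pose V := (2^-1)%:C *: invmx (K x).
have V0 : 0 < 2^-1 :> R by rewrite invr_gt0.
have VE v : hform V v v = 2^-1 * hform (invmx (K x)) v v.
  by rewrite /hform -scalemxAr -scalemxAl mxE Re_realM.
have c0 : 0 <= s * 2 / D.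
  by apply: divr_ge0; [apply: mulr_ge0 => //|]; exact: ltW.
apply: (@le_trans _ _ (\int[lebn R (2 * M)]_y
    (s * 2 / D * expR (- hform V (cvec y) (cvec y)))%:E)%E).
  apply: ge0_le_integralr.
  - apply: measurable_funM; last exact: measurable_sqnorm_cvec.
    under eq_fun do rewrite pdens_cst.
    by apply: measurable_funM => //; exact: measurable_cgauss.
  - by apply: measurable_funM => //; exact: measurable_cgauss.
  - by move=> y; rewrite mulr_ge0 ?sqnorm_ge0// ltW// pdens_gt0.
  - move=> y; rewrite pdens_cst -/D VE; move: (cvec y) => {}y.
    set q := hform _ y y.
    have nq : sqnorm y <= s * q.
      rewrite -ler_pdivrMl//; apply: hform_invmx_ge => // u.
      by have /andP[] := Kl x u.
    have qe : q <= 2 * expR (2^-1 * q).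
      by have := expR_ge1Dx (2^-1 * q); lra.
    have -> : expR (- q) = expR (- (2^-1 * q)) * expR (- (2^-1 * q)).
      by rewrite -expRD; congr expR; lra.
    have e1 : expR (- (2^-1 * q)) * expR (2^-1 * q) = 1.
      by rewrite -expRD addNr expR0.
    have e0 := expR_gt0 (- (2^-1 * q)).
    have i0 : 0 <= D^-1 by rewrite invr_ge0 ltW.
    move: e0 e1 qe nq i0.
    move: (expR (- (2^-1 * q))) (expR (2^-1 * q)) (D^-1) => e e' i e0 e1 qe nq i0.
    have -> : i * (e * e) * sqnorm y = i * e * (e * sqnorm y) by ring.
    have -> : s * 2 * i * e = i * e * (e * (s * (2 * e'))).
      by rewrite -[LHS]mulr1 -e1; ring.
    rewrite ler_wpM2l ?mulr_ge0 ?(ltW e0)// ler_pM2l//.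
    by apply: le_trans nq _; rewrite ler_pM2l.
rewrite ge0_integralZlr//; last exact: measurable_cgauss.
rewrite (integral_cgauss (herm_pdZ V0 pdV)) -EFinM lee_fin.
rewrite detZ -rmorphXn Re_realM Re_det_invmx//.
have dK := Re_det_gt0 pdK.
have pi0 : 0 < pi ^+ M :> R by rewrite exprn_gt0 ?pi_gt0.
have h2 : 0 < 2 ^+ M :> R by rewrite exprn_gt0.
rewrite le_eqVlt; apply/orP; left; apply/eqP.
rewrite /D /s exprVn exprS; field.
by rewrite !gt_eqF.
Qed.

Lemma pdens_low (k : R) : 0 < k -> exists R1 : R, forall R2 : R,
  exists2 c : R, 0 < c & forall x : 'cV[C]_N, R1 <= sqnorm x <= R2 ->
    forall y, c * expR (- (k * sqnorm y)) <= p y x.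
Proof.
move=> k0; have [l [L [l0 L0 Kl]]] := covK_bounds.
have pi0 : 0 < pi ^+ M :> R by rewrite exprn_gt0 ?pi_gt0.
(* Beyond this power [covK] dominates [k^-1], so its inverse is at most [k]. The bound [R2] serves
   only to keep the determinant below [s ^+ M]. *)
exists (k * l)^-1 => R2; set s := sZ2 + L * `|R2|.
have s0 : 0 < s by rewrite ltr_wpDr// mulr_ge0// ltW.
exists (pi ^+ M * s ^+ M)^-1; first by rewrite invr_gt0 mulr_gt0// exprn_gt0.
move=> x /andP[R1x xR2] y; rewrite pdens_cst.
have pdK := herm_pd_covK x; have dK := Re_det_gt0 pdK.
apply: ler_pM; rewrite ?expR_ge0 ?invr_ge0 ?mulr_ge0 ?exprn_ge0 ?pi_ge0 ?(ltW s0)//.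
  have ps0 : 0 < pi ^+ M * s ^+ M by rewrite mulr_gt0// exprn_gt0.
  have pd0 := pdens_den_gt0 x.
  rewrite lef_pV2 ?posrE// ler_pM2l//.
  apply: det_covK_le => // v; have /andP[_ /le_trans] := Kl x v; apply.
  rewrite ler_wpM2r ?sqnorm_ge0// lerD2l ler_pM2l//.
  exact: le_trans xR2 (ler_norm _).
rewrite ler_expR lerN2.
have Kv v : k^-1 * sqnorm v <= hform (K x) v v.
  have /andP[+ _] := Kl x v; apply: le_trans; rewrite ler_wpM2r ?sqnorm_ge0//.
  have : k^-1 <= l * sqnorm x.
    by rewrite -ler_pdivrMl// -invfM mulrC.
  by move=> h; apply: le_trans h _; rewrite lerDr ltW.
have := hform_invmx_le pdK y (l := k^-1); rewrite invr_gt0 invrK; exact.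
Qed.

Lemma pdens_flat (G : R) : (0 < M)%N -> exists R1 : R, forall x : 'cV[C]_N, R1 <= sqnorm x ->
  (G%:E <= \int[lebn R (2 * M)]_y (p (cvec y) x * ln (1 + sqnorm (cvec y)))%:E)%E.
Proof.
move=> M0; have [l [L [l0 L0 Kl]]] := covK_bounds.
have pi0 : 0 < pi ^+ M :> R by rewrite exprn_gt0 ?pi_gt0.
(* Where [sqnorm y >= expR T] the logarithm is at least [T]. On the rest,
   [1 <= c * expR (- sqnorm y)], so the lost part has integral at most [T c / det], which is at most
   1 far out. *)
pose T := `|G| + 1; pose c := expR (expR T).
have T0 : 0 < T by rewrite ltr_wpDl.
have c0 : 0 < c by exact: expR_gt0.
have Tc0 : 0 < T * c by rewrite mulr_gt0.
exists ((1 + T * c) / l) => x xR.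
have pdK := herm_pd_covK x; have dK := Re_det_gt0 pdK.
have d0 := pdens_den_gt0 x; set D := pi ^+ M * _ in d0.
have detK : T * c <= complex.Re (\det (K x)).
  have s1 : 1 + T * c <= sZ2 + l * sqnorm x.
    by move: xR; rewrite ler_pdivrMr// (mulrC _ l) => h; apply: le_trans h _; rewrite lerDr ltW.
  apply: (@le_trans _ _ ((sZ2 + l * sqnorm x) ^+ M)).
    apply: (@le_trans _ _ (sZ2 + l * sqnorm x)); first by lra.
    (* The base is at least 1, thanks to the [1 +] in the radius, and [M] is positive, so the power
       dominates the base. *)
    rewrite -{1}[sZ2 + _]expr1; apply: ler_weXn2l => //; lra.
  apply: det_covK_ge => [|v]; first exact: pos_aff.
  by have /andP[] := Kl x v.
have lnn (y : 'cV[C]_M) : 0 <= ln (1 + sqnorm y) by rewrite ln_ge0// lerDl sqnorm_ge0.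
have mp : measurable_fun setT (fun y : Rn R (2 * M) => p (cvec y) x).
  under eq_fun do rewrite pdens_cst.
  by apply: measurable_funM => //; exact: measurable_cgauss.
have mpl : measurable_fun setT (fun y : Rn R (2 * M) =>
    p (cvec y) x * ln (1 + sqnorm (cvec y))).
  apply: measurable_funM => //; apply: (measurableT_comp (@measurable_ln R)).
  by apply: measurable_funD => //; exact: measurable_sqnorm_cvec.
have mg : measurable_fun setT (fun y : Rn R (2 * M) =>
    T * c / D * expR (- hform (1%:M : 'M[C]_M) (cvec y) (cvec y))).
  by apply: measurable_funM => //; exact: measurable_cgauss.
have TcD0 : 0 <= T * c / D by rewrite divr_ge0// ltW.
have pl0 (y : Rn R (2 * M)) : 0 <= p (cvec y) x * ln (1 + sqnorm (cvec y)).
  by rewrite mulr_ge0// ltW// pdens_gt0.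
have : (\int[lebn R (2 * M)]_y (T * p (cvec y) x)%:E <= \int[lebn R (2 * M)]_y
  (p (cvec y) x * ln (1 + sqnorm (cvec y)) +
   T * c / D * expR (- hform (1%:M : 'M[C]_M) (cvec y) (cvec y)))%:E)%E.
  apply: ge0_le_integralr.
  - exact: measurable_funM.
  - exact: measurable_funD.
  - by move=> y; rewrite mulr_ge0 ?ltW// pdens_gt0.
  - move=> y; rewrite -sqnormE; move: (cvec y) => {}y.
    have [nT|nT] := leP (expR T) (sqnorm y).
      apply: ler_wpDr; first exact: mulr_ge0 TcD0 (expR_ge0 _).
      rewrite mulrC ler_pM2l ?pdens_gt0//.
      rewrite -[leLHS]expRK ler_ln ?posrE ?expR_gt0 ?ltr_wpDr ?sqnorm_ge0//.
      by rewrite (le_trans nT)// lerDr.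
    apply: ler_wpDl; first by rewrite mulr_ge0// ltW// pdens_gt0.
    rewrite -!mulrA ler_pM2l// pdens_cst -/D [leRHS]mulrCA ler_pM2l ?invr_gt0//.
    rewrite -expRD; apply: (@le_trans _ _ (expR 0)); rewrite ler_expR.
      by rewrite oppr_le0; apply: hform_ge0; exact: herm_pd_invmx.
    by rewrite subr_ge0 ltW.
have p0 (y : Rn R (2 * M)) : 0 <= p (cvec y) x by rewrite ltW// pdens_gt0.
have pd1 : herm_pd (1%:M : 'M[C]_M) by exact: (@herm_pd_scalar R M 1 ltr01).
rewrite ge0_integralZlr ?(ltW T0)// pdens_int mule1.
rewrite ge0_integralDr//; last by move=> y; rewrite mulr_ge0 ?expR_ge0.
rewrite ge0_integralZlr//; last exact: measurable_cgauss.
rewrite (integral_cgauss pd1) det1 /= divr1 -EFinM => h.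
rewrite -(leeD2rE (x := (T * c / D * pi ^+ M)%:E))//; apply: le_trans h.
rewrite -EFinD lee_fin.
have -> : T * c / D * pi ^+ M = T * c / complex.Re (\det (K x)).
  by rewrite /D; field; rewrite !gt_eqF.
have : T * c / complex.Re (\det (K x)) <= 1 by rewrite ler_pdivrMr// mul1r.
have := ler_norm G; rewrite /T; lra.
Qed.

Lemma measurable_pdens : measurable_fun setT
  (fun z : Rn R (2 * N) * Rn R (2 * M) => p (cvec z.2) (cvec z.1)).
Proof.
have mx : mxmeasurable (fun z : Rn R (2 * N) * Rn R (2 * M) => cvec z.1).
  move=> i j; have [m1 m2] := @mxmeasurable_cvec R N i j.
  by split; [exact: (measurableT_comp m1 measurable_fst)|
             exact: (measurableT_comp m2 measurable_fst)].
have my : mxmeasurable (fun z : Rn R (2 * N) * Rn R (2 * M) => cvec z.2).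
  move=> i j; have [m1 m2] := @mxmeasurable_cvec R M i j.
  by split; [exact: (measurableT_comp m1 measurable_snd)|
             exact: (measurableT_comp m2 measurable_snd)].
have mk : mxmeasurable (fun z : Rn R (2 * N) * Rn R (2 * M) => kronIx M (cvec z.1)).
  move=> i j; rewrite /kronIx; under eq_fun do rewrite castmxE mxE.
  by apply: cmeasurableM; [exact: cmeasurable_cst|exact: mx].
have mK : mxmeasurable (fun z : Rn R (2 * N) * Rn R (2 * M) => K (cvec z.1)).
  apply: mxmeasurableD; first exact: mxmeasurable_cst.
  apply: mxmeasurableM => //; apply: mxmeasurableM; last exact: mxmeasurable_cst.
  exact: mxmeasurable_mxH.
under eq_fun do rewrite pdensE.
apply: measurable_funM.
  apply: measurableT_comp => //; apply: measurable_funN; apply: measurable_hform => //.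
  by apply: mxmeasurable_invmx => // z; exact/herm_pd_det_gt0/herm_pd_covK.
apply: gt0_measurable_funV; last by move=> z; exact: pdens_den_gt0.
apply: measurable_funM => //; exact: (cmeasurable_det mK).1.
Qed.

End ChannelBounds.

(** The abstract contradiction is applied with squared norms as [pw] and [nrm]. Any competitor using
    no more power than [mu0] is admissible for [a], so attainment of the capacity gives the
    maximality needed. *)
Theorem theorem2 (R : realType) (M N : nat) (sZ2 : R)
  (Sigma : 'M[R[i]]_(M * N)) (a : R)
  (mu0 : probability (Rn R (2 * N)) R) :
  (0 < M)%N -> (0 < N)%N -> 0 < sZ2 -> herm_pd Sigma -> 0 < a ->
  @power_ok R N a mu0 ->
  @mutinf R M N sZ2 Sigma mu0 = @chan_capacity R M N sZ2 Sigma a ->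
  @bounded_cset R N (@msupport R N mu0).
Proof.
move=> M0 N0 sZ20 pdS _ pow cap; apply: contrapT => unb.
have mpw := @measurable_sqnorm_cvec R N.
have pw0 (x : Rn R (2 * N)) : 0 <= sqnorm (cvec x) by exact: sqnorm_ge0.
have powE (nu : probability (Rn R (2 * N)) R) :
    (\int[nu]_x (sqnorm (cvec x) / N%:R)%:E
     = (N%:R^-1)%:E * \int[nu]_x (sqnorm (cvec x))%:E)%E.
  by under eq_integral do rewrite mulrC; rewrite ge0_integralZlr ?invr_ge0.
have NV0 : 0 < N%:R^-1 :> R by rewrite invr_gt0 ltr0n.
have pw_fin : (\int[mu0]_x (sqnorm (cvec x))%:E < +oo)%E.
  move: pow; rewrite /power_ok powE => pow.
  have := @ge0_integralr_ge0 _ _ _ mu0 _ pw0; move: pow.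
  (* An infinite second moment would stay infinite after scaling by [N%:R^-1], against [pow]. *)
  case: (integral _ _ _) => [r _ _|+ _|_]; [exact: ltry| |by []].
  by rewrite gt0_muley ?lte_fin.
have [A [B [AB mom]]] := pdens_mom sZ20 pdS.
apply: (maximizer_not_unbounded (measurable_pdens sZ20 pdS)
  (fun y x => pdens_gt0 sZ20 pdS (cvec y) (cvec x))
  (fun x => pdens_int sZ20 pdS (cvec x))
  (pmax := (pi ^+ M * sZ2 ^+ M)^-1)
  (fun y x => pdens_le sZ20 pdS (cvec y) (cvec x))
  (@measurable_sqnorm_cvec R M) (fun y => sqnorm_ge0 (cvec y)) mpw pw0 AB
  (fun x => mom (cvec x)) _ _ pw_fin).
- move=> k k0; have [R1 H] := pdens_low sZ20 pdS k0; exists R1 => R2.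
  by have [c c0 Hc] := H R2; exists c => // x xR y; exact: Hc.
- by move=> G; have [R1 H] := pdens_flat sZ20 pdS G M0; exists R1 => x; exact: H.
- move=> nu nupw.
  have -> : minfo (lebn R (2 * M)) (fun y x => pdens sZ2 Sigma (cvec y) (cvec x)) mu0
    = mutinf sZ2 Sigma mu0 by [].
  rewrite cap; apply: ereal_sup_ubound; exists nu; split => //.
  rewrite /power_ok powE; apply: le_trans pow.
  by rewrite powE lee_wpmul2l// lee_fin ltW.
(* The unit ball around such an [x0] is charged. From [|x0|^2 <= 2 (|x|^2 + |x - x0|^2)] every point
   of it has squared norm above [|R1|], which explains the constant. *)
- move=> R1; have [x0 x0S x0n] : exists2 x0, msupport mu0 x0 & 2 * (`|R1| + 1) < sqnorm x0.
    apply: contrapT => h; apply: unb; exists (2 * (`|R1| + 1)) => x xS.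
    by rewrite leNgt; apply/negP => xn; apply: h; exists x.
  exists [set x : Rn R (2 * N) | sqnorm (cvec x - x0) < 1 ^+ 2], (2 * (1 + sqnorm x0)).
  split.
  + rewrite -[X in measurable X]setTI.
    rewrite (_ : [set _ | _] = (fun x : Rn R (2 * N) =>
      sqnorm (cvec x - x0)) @^-1` `]-oo, (1 : R)[%classic).
      have mf : measurable_fun setT (fun x : Rn R (2 * N) => sqnorm (cvec x - x0)).
        under eq_fun do rewrite sqnormE; apply: measurable_hform;
          [|exact: mxmeasurable_cst|];
          (apply: mxmeasurableD; [exact: mxmeasurable_cvec|exact: mxmeasurable_cst]).
      by apply: mf => //; exact: measurable_itv.
    by apply/seteqP; split => x /=; rewrite in_itv/= expr1n.
  + exact: x0S ltr01.
  + move=> x /=; rewrite expr1n => x1.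
    have h1 := sqnormD_le (cvec x) (- (cvec x - x0)); move: h1.
    rewrite sqnormN opprB addrCA subrr addr0 => h1.
    have h2 := sqnormD_le (cvec x - x0) x0; move: h2.
    rewrite subrK => h2.
    have := ler_norm R1; move=> h3; apply/andP; split; lra.
Qed.
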